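(* Let $\alpha\in(1,2]$. There exist $a_\alpha>0$ and $C_\alpha<\infty$ such that the probability measure $\mu_\alpha(dx)=\frac{1}{Z_\alpha}e^{-|x|^\alpha}dx$ on $\mathbb{R}$ (with $Z_\alpha=\int e^{-|x|^\alpha}dx$) satisfies a logarithmic Sobolev inequality of function $H_{a_\alpha,\alpha}$ with constant $C_\alpha$, i.e. satisfies $LSI_{a_\alpha,\alpha}(C_\alpha)$.
   Context: For $\alpha\in(1,2]$ let $\beta\ge2$ satisfy $1/\alpha+1/\beta=1$, and for $a>0$, $x\in\mathbb{R}$, let $H_{a,\alpha}(x)=\frac{x^2}{2}$ if $|x|\le a$ and $H_{a,\alpha}(x)=a^{2-\beta}\frac{|x|^\beta}{\beta}+a^2\frac{\beta-2}{2\beta}$ if $|x|\ge a$. A probability measure $\mu$ on $\mathbb{R}$ satisfies $LSI_{a,\alpha}(C)$ if for every $C^\infty$ and $L^2$ function $f$ on $\mathbb{R}$, $$\mathbf{Ent}_\mu(f^2)\le C\int H_{a,\alpha}\Big(\frac{f'}{f}\Big)f^2d\mu,\qquad \mathbf{Ent}_\mu(f^2)=\int f^2\log\frac{f^2}{\int f^2d\mu}d\mu,$$ with the convention $0/0=\infty$. *)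

(* Defs.v *)
From HB Require Import structures.
From mathcomp Require Import all_boot all_order all_algebra.
From mathcomp Require Import all_classical all_reals all_analysis.
From mathcomp Require Import measurable_realfun.

Set Implicit Arguments.
Unset Strict Implicit.
Unset Printing Implicit Defensive.

Import Order.TTheory GRing.Theory Num.Theory.
Import numFieldNormedType.Exports.

Local Open Scope classical_set_scope.
Local Open Scope ring_scope.

Section cost_function.
Context {R : realType}.
Implicit Types (a alpha x y : R).

Definition conj_exp alpha : R := fine (hoelder_conjugate alpha%:E).

Lemma conj_expE alpha : 1 < alpha -> conj_exp alpha = alpha / (alpha - 1).
Proof.
move=> a1; rewrite /conj_exp /hoelder_conjugate/=.
have a0 : alpha != 0 by rewrite gt_eqF// (lt_trans _ a1).
rewrite eqe (negbTE a0) -EFinB inver subr_eq0 (gt_eqF a1).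
by rewrite -EFinM.
Qed.

Lemma conj_exp_eq1 alpha : 1 < alpha -> alpha^-1 + (conj_exp alpha)^-1 = 1.
Proof.
move=> a1; rewrite conj_expE// invf_div.
have a0 : alpha != 0 by rewrite gt_eqF// (lt_trans _ a1).
by rewrite mulrBl divff// mul1r addrC subrK.
Qed.

Lemma conj_exp_ge2 alpha : 1 < alpha -> alpha <= 2 -> 2 <= conj_exp alpha.
Proof.
move=> a1 a2; rewrite conj_expE// ler_pdivlMr ?subr_gt0//.
by rewrite mulrBr mulr1 lerBlDr mulr_natl mulr2n lerD2l.
Qed.

(* The two branches agree at |x| = a. *)
Definition Hfun a alpha x : R :=
  let b := conj_exp alpha in
  if `|x| <= a then x ^+ 2 / 2
  else a `^ (2 - b) * (`|x| `^ b / b) + a ^+ 2 * ((b - 2) / (2 * b)).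

(* Extension of the even function [Hfun] by its limit at infinity. *)
Definition eHfun a alpha (z : \bar R) : \bar R :=
  if z is r%:E then (Hfun a alpha r)%:E else +oo%E.

(* Quotient with 0 / 0 = oo. For y != 0, [y%:E / 0] is already +oo or -oo, but
   the library's 0%:E / 0%:E is 0. *)
Definition quot (y x : R) : \bar R :=
  if (y == 0) && (x == 0) then +oo%E else (y%:E / x%:E)%E.

End cost_function.

Section log_sobolev.
Context {R : realType}.
Implicit Types (mu : probability (measurableTypeR R) R) (f g : R -> R).

Definition smooth f := forall n x, derivable f^`(n)%classic x 1.

(* [ln 0 = 0] here, so the integrand vanishes where g does, also when the
   integral of g is 0. *)
Definition Ent mu g : \bar R :=
  (\int[mu]_x (g x * ln (g x / \int[mu]_y (g y)))%R%:E)%E.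

(* Where f = 0 the first factor is +oo and the second is 0; their product in
   [\bar R] is 0, as usual in measure theory. L^2 means L^2(mu). *)
Definition LSI mu (a alpha C : R) :=
  forall f, smooth f -> f \in Lfun mu 2%:E ->
    (Ent mu (fun x => f x ^+ 2)%R <=
     C%:E * \int[mu]_x (eHfun a alpha (quot (f^`()%classic x) (f x)) * (f x ^+ 2)%R%:E))%E.

End log_sobolev.

Section exp_power_measure.
Context {R : realType}.
Notation leb := (@lebesgue_measure R).

Definition exp_power (alpha x : R) : R := expR (- (`|x| `^ alpha)).

Definition Zconst (alpha : R) : R := \int[leb]_x exp_power alpha x.

Definition mu_fun (alpha : R) (A : set (measurableTypeR R)) : \bar R :=
  (\int[leb]_(x in A) ((Zconst alpha)^-1 * exp_power alpha x)%:E)%E.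

Lemma exp_power_ge0 alpha x : 0 <= exp_power alpha x.
Proof. exact: expR_ge0. Qed.

Lemma measurable_exp_power alpha : measurable_fun [set: R] (exp_power alpha).
Proof.
apply: measurableT_comp => //; apply: measurableT_comp => //.
apply: (@measurableT_comp _ _ _ _ _ _ (@powR R ^~ alpha)) => //.
Qed.

Lemma Zconst_ge0 alpha : 0 <= Zconst alpha.
Proof. by apply: Rintegral_ge0 => x _; exact: exp_power_ge0. Qed.

Let pdf_ge0 alpha x : 0 <= (Zconst alpha)^-1 * exp_power alpha x.
Proof. by rewrite mulr_ge0 ?invr_ge0 ?Zconst_ge0 ?exp_power_ge0. Qed.

Let mpdf alpha :
  measurable_fun [set: R] (fun x => (Zconst alpha)^-1 * exp_power alpha x).
Proof. by apply: measurable_funM => //; exact: measurable_exp_power. Qed.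

Lemma integral_expRN_norm :
  (\int[leb]_x (expR (- `|x|))%:E <= 2%:E)%E.
Proof.
rewrite ge0_symfun_integralT; first last.
- by move=> x /=; rewrite normrN.
- move=> x; apply: continuous_comp; last exact: continuous_expR.
  by apply: continuousN; exact: norm_continuous.
- by move=> x; exact: expR_ge0.
rewrite -[leRHS]mule1 lee_pmul2l//.
have {1}<- := @integral_exponential_pdf R 1 ltr01.
rewrite (_ : integral _ _ _ =
    \int[leb]_(x in [set x | (0 <= x)%R]) (exponential_pdf 1 x)%:E)%E.
  apply: ge0_subset_integral => //.
  - by rewrite -set_itvcy.
  - by apply/measurable_EFinP; exact: measurable_exponential_pdf.
  - by move=> x _; rewrite lee_fin exponential_pdf_ge0.
apply: eq_integral => x; rewrite inE/= => x0.
by rewrite exponential_pdfE// mul1r mulN1r ger0_norm.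
Qed.

Lemma integral_exp_power_lty alpha : 1 < alpha ->
  (\int[leb]_x (exp_power alpha x)%:E < +oo)%E.
Proof.
move=> a1.
have mexp : measurable_fun [set: R] (fun x : R => expR (- `|x|)).
  apply: continuous_measurable_fun => x.
  apply: continuous_comp; last exact: continuous_expR.
  by apply: continuousN; exact: norm_continuous.
apply: (@le_lt_trans _ _ (\int[leb]_x (expR 1 * expR (- `|x|))%:E)%E).
  apply: ge0_le_integral => //.
  - by move=> x _; rewrite lee_fin exp_power_ge0.
  - by apply/measurable_EFinP; exact: measurable_exp_power.
  - by apply/measurable_EFinP; exact: measurable_funM.
  - move=> x _; rewrite lee_fin -expRD ler_expR lerNl opprD opprK addrC.
    have [x1|x1] := leP 1 `|x|.
      by rewrite lerBlDl (le_trans (le1r_powR x1 (ltW a1)))// lerDr.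
    by rewrite lerBlDl (le_trans (ltW x1))// lerDl powR_ge0.
under eq_integral do rewrite EFinM.
rewrite ge0_integralZl//.
- rewrite lte_mul_pinfty ?lee_fin ?expR_ge0//.
  exact: le_lt_trans integral_expRN_norm (ltry _).
- exact/measurable_EFinP.
Qed.

Lemma integral_exp_power_gt0 alpha : 1 < alpha ->
  (0 < \int[leb]_x (exp_power alpha x)%:E)%E.
Proof.
move=> a1.
apply: (@lt_le_trans _ _ (\int[leb]_(x in `[0%R, 1%R]) (expR (- 1))%:E)%E).
  rewrite integral_cst//= lebesgue_measure_itv/= lte_fin ltr01.
  by rewrite oppr0 adde0 mule1 lte_fin expR_gt0.
apply: (@le_trans _ _ (\int[leb]_(x in `[0%R, 1%R]) (exp_power alpha x)%:E)%E).
  apply: ge0_le_integral => //.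
  - apply/measurable_funTS/measurable_EFinP; exact: measurable_exp_power.
  - move=> x /=; rewrite in_itv/= => /andP[x0 x1].
    rewrite lee_fin ler_expR lerN2 ger0_norm//.
    have a0 : 0 <= alpha by rewrite (le_trans _ (ltW a1)).
    have := ge0_ler_powR a0 (x0 : x \is Num.nneg) (ler01 : 1 \is Num.nneg) x1.
    by rewrite powR1.
apply: ge0_subset_integral => //.
- by apply/measurable_EFinP; exact: measurable_exp_power.
- by move=> x _; rewrite lee_fin exp_power_ge0.
Qed.

Lemma Zconst_EFin alpha : 1 < alpha ->
  (Zconst alpha)%:E = (\int[leb]_x (exp_power alpha x)%:E)%E.
Proof.
move=> a1; rewrite /Zconst /Rintegral fineK// ge0_fin_numE.
  exact: integral_exp_power_lty.
exact/ltW/integral_exp_power_gt0.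
Qed.

Lemma Zconst_gt0 alpha : 1 < alpha -> 0 < Zconst alpha.
Proof.
by move=> a1; rewrite -lte_fin Zconst_EFin// integral_exp_power_gt0.
Qed.

Section instances.
Variable alpha : R.

Let mu_fun0 : mu_fun alpha set0 = 0%E.
Proof. by rewrite /mu_fun integral_set0. Qed.

Let mu_fun_ge0 A : (0 <= mu_fun alpha A)%E.
Proof. by apply: integral_ge0 => x _; rewrite lee_fin pdf_ge0. Qed.

Let mu_fun_sigma_additive : semi_sigma_additive (mu_fun alpha).
Proof.
move=> /= F mF tF mUF; rewrite /mu_fun; apply: cvg_toP.
  apply: ereal_nondecreasing_is_cvgn => m n mn.
  apply: lee_sum_nneg_natr => // k _ _; apply: integral_ge0 => /= x Fkx.
  by rewrite lee_fin pdf_ge0.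
rewrite ge0_integral_bigcup//=.
- by apply/measurable_funTS/measurable_EFinP; exact: mpdf.
- by move=> x _; rewrite lee_fin pdf_ge0.
Qed.

HB.instance Definition _ := isMeasure.Build _ _ _
  (mu_fun alpha) mu_fun0 mu_fun_ge0 mu_fun_sigma_additive.

Hypothesis alpha_gt1 : 1 < alpha.

Let mu_funT : mu_fun alpha [set: _] = 1%E.
Proof.
rewrite /mu_fun.
under eq_integral do rewrite EFinM.
rewrite ge0_integralZl//=.
- rewrite -Zconst_EFin// -EFinM mulVf// gt_eqF//; exact: Zconst_gt0.
- by apply/measurable_EFinP; exact: measurable_exp_power.
- by move=> x _; rewrite lee_fin exp_power_ge0.
- by rewrite lee_fin invr_ge0 Zconst_ge0.
Qed.

HB.instance Definition _ :=
  @Measure_isProbability.Build _ _ R (mu_fun alpha) mu_funT.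

Definition mu_alpha : probability (measurableTypeR R) R := mu_fun alpha.

End instances.

End exp_power_measure.

(* Main.v *)
Require Import Defs.
From mathcomp Require Import all_boot all_order all_algebra.
From mathcomp Require Import all_classical all_reals all_analysis.
From mathcomp Require Import measurable_realfun ring lra.
Import Order.TTheory GRing.Theory Num.Theory.
Import numFieldNormedType.Exports.
Local Open Scope classical_set_scope.
Local Open Scope ring_scope.

(* Take a = 1 and write E for the integral of H(f'/f) f^2, beta for the exponent
   conjugate to alpha, V = |x|^alpha, u = f^2, normalized by int u dmu = 1.
   Every estimate is an integrated differential inequality: if Phi >= 0 and
   Phi' <= r - b on the right of 0 (mirrored on the left), then
   int b <= Phi(0) + int r; this sign makes the boundary terms at infinity
   harmless.  It is applied to Phi = F w e^(-V).
   - With k = sqrt(1 + f^2), F = (k - k(0))^2 and w = 1 + e^(-|x|), it gives a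
     Poincare inequality int (k - k(0))^2 dmu <= C E.  Using k instead of f keeps
     the zeros of f harmless, since k' = f f'/k vanishes there.  It follows that
     Q = (u - 1)^2 / (1 + u) has integral at most C E.
   - With F = f^2 and w = 1, it gives the pointwise bound u <= (D0 + D1 E) e^V.
   - With F = Psi = (1 + u) q^n, q = (u - 1)/(u + 1), n even and n >= beta, and
     w = |x|, it gives int V Psi dmu <= C (int Psi dmu + E): the cross term is
     split by Young's inequality, the high power of q absorbing the region where
     u is close to 1.  Moreover Psi <= Q.
   Finally u ln u - (u - 1) is at most 5 Q where u <= 4, and where u > 4 it is at
   most u (V + D0 + D1 E), which is controlled by V Psi, Q and E u. *)

(** * Integration against a measure given by a density *)

Section density.
Context {d : measure_display} {T : measurableType d} {R : realType}.
Variables (mu nu : {measure set T -> \bar R}) (g : T -> R).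
Hypothesis g_ge0 : forall x, 0 <= g x.
Hypothesis mg : measurable_fun setT g.
Hypothesis mu_density : forall A, measurable A ->
  mu A = (\int[nu]_(x in A) (g x)%:E)%E.
Local Open Scope ereal_scope.

Import HBNNSimple.

Let integral_density_nnsfun (f : {nnsfun T >-> R}) :
  \int[mu]_x (f x)%:E = \int[nu]_x (f x * g x)%:E.
Proof.
under [LHS]eq_integral do rewrite fimfunE -fsumEFin//.
rewrite [LHS]ge0_integral_fsum//; last 2 first.
  - by move=> r; exact/measurable_EFinP/measurableT_comp.
  - by move=> n x _; rewrite EFinM nnfun_muleindic_ge0.
under [RHS]eq_integral.
  move=> x xD; rewrite EFinM muleC fimfunE -fsumEFin// ge0_mule_fsumr; last first.
    by move=> r; rewrite EFinM nnfun_muleindic_ge0.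
  over.
rewrite [RHS]ge0_integral_fsum//; last 2 first.
  - move=> r; apply/measurable_EFinP/measurable_funM => //.
    by apply: measurable_funM => //; exact: measurable_indic.
  - move=> n x _; rewrite mule_ge0//; last by rewrite EFinM nnfun_muleindic_ge0.
    by rewrite lee_fin.
apply: eq_fsbigr => r _.
have mA : measurable (f @^-1` [set r]) by [].
have [r0|r0] := leP 0%R r; last first.
  have A0 : f @^-1` [set r] = set0.
    by rewrite preimage10// => -[x _ fxr]; move: r0; rewrite -fxr ltNge fun_ge0.
  by rewrite A0 !integral0_eq// => x _; rewrite indic0 mulr0 ?mule0.
under eq_integral do rewrite EFinM.
rewrite ge0_integralZl//; last first.
  by apply/measurable_EFinP; exact: measurable_indic.
rewrite integral_indic// setIT mu_density//.
under [RHS]eq_integral do rewrite EFinM muleCA.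
rewrite ge0_integralZl//; last 2 first.
  - apply/measurable_EFinP/measurable_funM => //; exact: measurable_indic.
  - by move=> x _; rewrite mule_ge0// lee_fin.
congr (_ * _); rewrite integral_mkcond; apply: eq_integral => x _.
rewrite -EFinM restrict_EFin/= patchE indicE.
by case: ifPn => _; rewrite ?mulr1 ?mulr0.
Qed.

(** For nonnegative simple functions this is the density hypothesis on each level set. Both sides
    then pass to [f] by monotone convergence along the same approximating sequence. *)
Lemma ge0_integral_density (f : T -> R) : measurable_fun setT f ->
  (forall x, (0 <= f x)%R) -> \int[mu]_x (f x)%:E = \int[nu]_x (f x * g x)%:E.
Proof.
move=> mf f0.
have mEf : measurable_fun setT (EFin \o f) by exact/measurable_EFinP.
pose f_ := nnsfun_approx measurableT mEf.
transitivity (lim (\int[mu]_x (f_ n x)%:E @[n --> \oo])).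
  rewrite -monotone_convergence//=.
  - apply: eq_integral => x _; apply/esym/cvg_lim => //=.
    by apply: cvg_nnsfun_approx => // y _; rewrite lee_fin.
  - by move=> n; exact/measurable_EFinP/measurable_funTS.
  - by move=> n x _; rewrite lee_fin.
  - by move=> x _ a b ab; rewrite lee_fin; exact/lefP/nd_nnsfun_approx.
under eq_fun do rewrite integral_density_nnsfun.
rewrite -monotone_convergence//=.
- apply: eq_integral => x _; apply/cvg_lim => //=.
  under eq_fun do rewrite EFinM.
  rewrite EFinM; apply: cvgeZr => //.
  by apply: cvg_nnsfun_approx => // y _; rewrite lee_fin.
- by move=> n; apply/measurable_EFinP/measurable_funM.
- by move=> n x _; rewrite lee_fin mulr_ge0.
- move=> x _ a b ab; rewrite lee_fin ler_wpM2r//.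
  exact/lefP/nd_nnsfun_approx.
Qed.

End density.

(** * Lyapunov inequalities *)

Section lyapunov.
Context {R : realType}.
Implicit Types (Phi dPhi b r : R -> R).
Notation leb := (@lebesgue_measure R).

Lemma is_derive_continuous Phi dPhi :
  (forall x : R, is_derive x (1:R) Phi (dPhi x)) -> continuous Phi.
Proof.
by move=> dP x; apply/differentiable_continuous/derivable1_diffP; case: (dP x).
Qed.

(** Integrates Phi' + b <= r by the fundamental theorem of calculus. The derivative is asked only
    inside the segment, because |x|^alpha is differentiated only away from the origin. *)
Lemma lyapunov_segment Phi dPhi b r (x y : R) : x <= y ->
  continuous Phi -> continuous dPhi -> continuous b ->
  measurable_fun setT r -> (forall z, 0 <= b z) -> (forall z, 0 <= r z) ->
  (forall z, x < z < y -> is_derive z (1:R) Phi (dPhi z)) ->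
  (forall z, x <= z <= y -> dPhi z + b z <= r z) ->
  ((Phi y - Phi x)%:E + \int[leb]_(z in `[x, y]) (b z)%:E <=
   \int[leb]_(z in `[x, y]) (r z)%:E)%E.
Proof.
move=> xy cP cdP cb mr b0 r0 dP Pr.
move: xy; rewrite le_eqVlt => /predU1P[<-|xy].
  by rewrite subrr add0e set_itv1 !integral_set1.
have ci f : continuous f -> leb.-integrable `[x, y] (EFin \o f).
  move=> cf; apply: continuous_compact_integrable; first exact: segment_compact.
  exact: continuous_subspaceT.
rewrite EFinB -(@continuous_FTC2 _ dPhi Phi x y)//; last 3 first.
- exact: continuous_subspaceT.
- split.
  + by move=> z; rewrite in_itv/= => /dP[].
  + exact/cvg_at_right_filter/cP.
  + exact/cvg_at_left_filter/cP.
- by move=> z; rewrite in_itv/= => /dP dz; rewrite derive1E; exact: derive_val.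
rewrite -integralD_EFin//; [|exact: ci..].
(* [r] is only measurable, since the energy density may be discontinuous at zeros of f. Either its
   integral is infinite and the bound is trivial, or [r] is integrable. *)
have [roo|rfin] := eqVneq (\int[leb]_(z in `[x, y]) (r z)%:E)%E +oo%E.
  by rewrite roo leey.
apply: le_integral => //.
- by apply: integrableD => //; exact: ci.
- apply/integrableP; split; first by apply/measurable_funTS/measurable_EFinP.
  under eq_integral do rewrite /= ger0_norm//.
  by rewrite ltey.
- by move=> z; rewrite inE/= in_itv/= lee_fin => /Pr.
Qed.

Lemma integral_itvNn_le (f : R -> R) (M : \bar R) : measurable_fun setT f ->
  (forall x, 0 <= f x) ->
  (forall n : nat, \int[leb]_(x in `[(- n%:R)%R, n%:R%R]) (f x)%:E <= M)%E ->
  (\int[leb]_x (f x)%:E <= M)%E.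
Proof.
move=> mf f0 fM.
have bT : \bigcup_i `[- i%:R, i%:R]%classic = [set: R].
  rewrite -subTset => x _; exists (Num.truncn `|x|).+1 => //=.
  by rewrite in_itv/= -ler_norml ltW// truncnS_gt.
have := @ge0_nondecreasing_set_cvg_integral _ _ _
  (fun i : nat => `[- i%:R, i%:R]%classic : set (measurableTypeR R))
  (fun x => (f x)%:E) leb.
rewrite bT => /(_ _ _ _ _)/cvg_lim <-//.
- apply: lime_le; last by apply: nearW.
  apply: ereal_nondecreasing_is_cvgn => m n mn.
  apply: ge0_subset_integral => //.
  + by apply/measurable_funTS/measurable_EFinP.
  + by move=> x _; rewrite lee_fin.
  + by apply: subset_itv; rewrite bnd_simp ?lerN2 ler_nat.
- move=> m n mn; rewrite subsetEset; apply: subset_itv;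
  by rewrite bnd_simp ?lerN2 ler_nat.
- by move=> i; apply/measurable_funTS/measurable_EFinP.
- by move=> i x _; rewrite lee_fin.
Qed.

(** * Both half-lines at once: s = 1 is the right one, s = -1 the left one, and [s * dPhi s x] is
    the outward derivative *)

Section two_sided.
Variables (Phi dPhi : R -> R -> R) (b r : R -> R).
Hypothesis cPhi : forall s, continuous (Phi s).
Hypothesis cdPhi : forall s, continuous (dPhi s).
Hypothesis cb : continuous b.
Hypothesis mr : measurable_fun setT r.
Hypothesis b_ge0 : forall x, 0 <= b x.
Hypothesis r_ge0 : forall x, 0 <= r x.
Hypothesis Phi_ge0 : forall s x : R, 0 <= s * x -> 0 <= Phi s x.
Hypothesis dPhiE : forall s x : R, `|s| = 1 -> 0 < s * x ->
  is_derive x (1:R) (Phi s) (dPhi s x).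
Hypothesis dPhi_le : forall s x : R, `|s| = 1 -> 0 <= s * x ->
  s * dPhi s x + b x <= r x.

Let right x : 0 <= x -> ((Phi 1 x - Phi 1 0)%:E +
    \int[leb]_(z in `[0%R, x]) (b z)%:E <= \int[leb]_(z in `[0%R, x]) (r z)%:E)%E.
Proof.
move=> x0; apply: (@lyapunov_segment _ (dPhi 1)) => //.
- by move=> z /andP[z0 _]; apply: dPhiE; rewrite ?normr1// mul1r.
- move=> z /andP[z0 _]; rewrite -[dPhi _ _]mul1r.
  by apply: dPhi_le; rewrite ?normr1// mul1r.
Qed.

(** Applied to [- Phi (-1)], whose derivative is the outward one, so no change of variable is
    needed. *)
Let left x : x <= 0 -> ((Phi (-1) x - Phi (-1) 0)%:E +
    \int[leb]_(z in `[x, 0%R]) (b z)%:E <= \int[leb]_(z in `[x, 0%R]) (r z)%:E)%E.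
Proof.
move=> x0.
have -> : Phi (-1) x - Phi (-1) 0 = - Phi (-1) 0 - - Phi (-1) x by ring.
apply: (@lyapunov_segment (fun z => - Phi (-1) z) (fun z => - dPhi (-1) z)) => //.
- by move=> z; apply/continuousN/cPhi.
- by move=> z; apply/continuousN/cdPhi.
- move=> z /andP[_ z0].
  have := dPhiE (-1) z; rewrite normrN1 mulN1r oppr_gt0 => /(_ erefl z0) dz.
  exact: is_deriveN.
- move=> z /andP[_ z0]; rewrite -[- dPhi _ _]mulN1r.
  by apply: dPhi_le; rewrite ?normrN1// mulN1r oppr_ge0.
Qed.

Let int_sub (f : R -> R) (A : set R) : measurable_fun setT f -> (forall x, 0 <= f x) ->
  measurable A -> (\int[leb]_(x in A) (f x)%:E <= \int[leb]_x (f x)%:E)%E.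
Proof.
move=> mf f0 mA; apply: ge0_subset_integral => //.
- exact/measurable_EFinP.
- by move=> x _; rewrite lee_fin.
Qed.

(** Integrate between 0 and x, drop the nonnegative integral of [b], and enlarge the domain of the
    integral of [r]. *)
Lemma lyapunov_pointwise s x : `|s| = 1 -> 0 <= s * x ->
  ((Phi s x)%:E <= (Phi s 0)%:E + \int[leb]_z (r z)%:E)%E.
Proof.
have bge A : (0 <= \int[leb]_(z in A) (b z)%:E)%E.
  by apply: integral_ge0 => z _; rewrite lee_fin.
have main (A : set R) : measurable A ->
  ((Phi s x - Phi s 0)%:E + \int[leb]_(z in A) (b z)%:E <=
    \int[leb]_(z in A) (r z)%:E)%E ->
  ((Phi s x)%:E <= (Phi s 0)%:E + \int[leb]_z (r z)%:E)%E.
  move=> mA h; rewrite -leeBlDl// -EFinB.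
   apply: (le_trans _ (int_sub _ _ mr r_ge0 mA)); apply: le_trans h.
  by rewrite leeDl.
move=> /eqP; rewrite eqr_norml ler01 andbT => /orP[] /eqP sE; rewrite sE.
  by rewrite mul1r => /right; rewrite -sE; apply: main.
by rewrite mulN1r oppr_ge0 => /left; rewrite -sE; apply: main.
Qed.

(** On each half of [-n, n] the value of [Phi] at the outer end is nonnegative and is dropped, so no
    decay at infinity is required. The factor 2 arises because the integral of [r] over each half is
    bounded by the one over the whole line. *)
Lemma lyapunov_integral :
  (\int[leb]_z (b z)%:E <=
   (Phi 1 0 + Phi (-1) 0)%:E + 2%:E * \int[leb]_z (r z)%:E)%E.
Proof.
have mb : measurable_fun setT b by exact: continuous_measurable_fun.
have main (A : set R) u v : 0 <= u -> measurable A ->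
  ((u - v)%:E + \int[leb]_(z in A) (b z)%:E <=
    \int[leb]_(z in A) (r z)%:E)%E ->
  (\int[leb]_(z in A) (b z)%:E <= v%:E + \int[leb]_z (r z)%:E)%E.
  move=> u0 mA h; rewrite -leeBlDl// addeC.
  apply: (le_trans _ (int_sub _ _ mr r_ge0 mA)); apply: le_trans h.
  by rewrite leeD2r// -EFinN lee_fin; lra.
apply: integral_itvNn_le => // n.
have -> : `[- n%:R, n%:R]%classic = `[- n%:R, 0%R[%classic `|` `[0%R, n%:R]%classic :> set R.
  by rewrite -itv_bndbnd_setU// bnd_simp ?oppr_le0.
rewrite ge0_integral_setU//=; last 3 first.
- by apply/measurable_funTS/measurable_EFinP.
- by move=> x _; rewrite lee_fin.
- apply/disj_setPS => x /=; rewrite !in_itv/= => -[/andP[_ x0] /andP[]].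
  by rewrite leNgt x0.
rewrite integral_itv_bndo_bndc; last by apply/measurable_funTS/measurable_EFinP.
have split (u v : R) (I : \bar R) :
    ((u + v)%:E + 2%:E * I = (v%:E + I) + (u%:E + I))%E.
  by rewrite EFinD mule_natl mule2n (addeC u%:E) addeACA.
rewrite split; apply: leeD.
- apply: (main _ (Phi (-1) (- n%:R))) => //; last by apply: left; rewrite oppr_le0.
  by apply: Phi_ge0; rewrite mulrNN mul1r.
- apply: (main _ (Phi 1 n%:R)) => //; last exact: right.
  by apply: Phi_ge0; rewrite mul1r.
Qed.

End two_sided.
End lyapunov.

(** * Continuity and derivatives, in particular of exp(-|x|^alpha) *)

Section exp_power_calculus.
Context {R : realType}.

Section pointwise_calculus.
Implicit Types f g : R -> R.

Lemma continuous_funD f g : continuous f -> continuous g ->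
  continuous (fun x => f x + g x).
Proof. move=> cf cg x; exact: (continuousD (cf x) (cg x)). Qed.

Lemma continuous_funB f g : continuous f -> continuous g ->
  continuous (fun x => f x - g x).
Proof. move=> cf cg x; exact: (continuousB (cf x) (cg x)). Qed.

Lemma continuous_funM f g : continuous f -> continuous g ->
  continuous (fun x => f x * g x).
Proof. move=> cf cg x; exact: (continuousM (cf x) (cg x)). Qed.

Lemma continuous_funX f n : continuous f -> continuous (fun x => f x ^+ n).
Proof.
move=> cf; elim: n => [|n ih].
  by move=> x; exact: cvg_cst.
under eq_fun do rewrite exprS.
exact: continuous_funM.
Qed.

Lemma continuous_funV f : (forall x, f x != 0) -> continuous f ->
  continuous (fun x => (f x)^-1).
Proof. move=> f0 cf x; exact: (continuousV (f0 x) (cf x)). Qed.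

Lemma is_derive_funM f g (x a b : R) :
  is_derive x (1 : R) f a -> is_derive x (1 : R) g b ->
  is_derive x (1 : R) (fun y => f y * g y) (f x * b + g x * a).
Proof. exact: is_deriveM. Qed.

Lemma is_derive_fun_comp f g (x a b : R) :
  is_derive (f x) (1 : R) g a -> is_derive x (1 : R) f b ->
  is_derive x (1 : R) (fun y => g (f y)) (a * b).
Proof. by move=> ga fb; exact: is_derive1_comp. Qed.

Lemma is_derive_funX f n (x a : R) : is_derive x (1 : R) f a ->
  is_derive x (1 : R) (fun y => f y ^+ n) (n%:R * f x ^+ n.-1 * a).
Proof.
move=> fa; elim: n => [|n ih].
  by rewrite !mul0r; exact: is_derive_cst.
under eq_fun do rewrite exprS.
apply: (is_derive_eq (is_derive_funM _ _ _ _ _ fa ih)).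
by case: n {ih} => [|n] /=; rewrite -?[n.+2%:R]natr1 ?[f x ^+ n.+1]exprS; ring.
Qed.

End pointwise_calculus.

Lemma continuous_norm_powR (c : R) : 0 < c -> continuous (fun x : R => `|x| `^ c).
Proof.
move=> c0 x; have [->|x0] := eqVneq x 0.
  apply/cvgrPdist_lt => e e0; near=> y.
  rewrite normr0 powR0 ?gt_eqF// sub0r normrN ger0_norm ?powR_ge0//.
  (* At the origin, e is written as the c-th power of e^(1/c), which reduces the claim to |y| <
     e^(1/c). *)
  rewrite -[ltRHS](powRr1 (ltW e0)) -(mulVf (lt0r_neq0 c0)) powRrM.
  apply: gt0_ltr_powR; rewrite ?nnegrE ?powR_ge0 ?normr_ge0//.
  near: y; apply: (@nbhs0_lt _ R); first by rewrite powR_gt0.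
apply: (@continuous_comp _ _ _ (fun y : R => `|y|) (fun y => y `^ c)).
  exact: norm_continuous.
apply/differentiable_continuous/derivable1_diffP.
by apply: derivable_powR; rewrite in_itv/= andbT normr_gt0.
Unshelve. all: by end_near. Qed.

Variable alpha : R.
Hypothesis alpha_gt1 : 1 < alpha.
Let p := @exp_power R alpha.
Let alpha_gt0 : 0 < alpha. Proof. exact: lt_trans alpha_gt1. Qed.

Lemma continuous_exp_power : continuous p.
Proof.
move=> x; apply: continuous_comp; last exact: continuous_expR.
by apply: continuousN; exact: continuous_norm_powR.
Qed.

Lemma exp_power0 : p 0 = 1.
Proof. by rewrite /p /exp_power normr0 powR0 ?gt_eqF// oppr0 expR0. Qed.

(** Near such a point |y| = s y, so |y|^alpha is locally a power of a positive linear function. *)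
Lemma is_derive_exp_power (s x : R) : `|s| = 1 -> 0 < s * x ->
  is_derive x (1 : R) p (- (s * (alpha * `|x| `^ (alpha - 1))) * p x).
Proof.
move=> s1 sx.
have s2 : s * s = 1 by rewrite -expr2 -real_normK ?num_real// s1 expr1n.
have nE (y : R) : 0 < s * y -> `|y| = s * y.
  by move=> sy; rewrite -[LHS]mul1r -s1 -normrM gtr0_norm.
have near_p : {near x, (fun y : R => expR (- ((s * y) `^ alpha))) =1 p}.
  have : \forall y \near x, 0 < s * y.
    have cs : {for x, continuous (fun y : R => s * y)}.
      by apply: continuousM => //; exact: cvg_cst.
    exact: (cvgr_gt _ cs).
  by apply: filterS => y sy; rewrite /p /exp_power nE.
apply: (near_eq_is_derive near_p).
have d1 : is_derive x (1 : R) (fun y : R => s * y) s.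
  by apply: is_derive_eq; rewrite /GRing.scale/= mulr1.
have d2 : is_derive x (1 : R) (fun y : R => (s * y) `^ alpha)
    (s * (alpha * (s * x) `^ (alpha - 1))).
  apply: (is_derive_eq (is_derive1_comp (is_derive1_powR alpha sx) d1)).
  by rewrite mulrC.
apply: (is_derive_eq (is_derive1_comp (is_derive_expR _) (is_deriveN d2))).
by rewrite /p /exp_power nE// mulrC.
Qed.

End exp_power_calculus.

(** * Lyapunov inequalities with respect to [mu_alpha] *)

Section weighted_lyapunov.
Context {R : realType}.
Notation leb := (@lebesgue_measure R).
Variable alpha : R.
Hypothesis alpha_gt1 : 1 < alpha.
Let p := @exp_power R alpha.
Let mu := mu_alpha alpha_gt1.
Let Z := @Zconst R alpha.

Lemma integral_mu_alpha (f : R -> R) : measurable_fun setT f ->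
  (forall x, 0 <= f x) ->
  (\int[leb]_x (f x * p x)%:E = Z%:E * \int[mu]_x (f x)%:E)%E.
Proof.
move=> mf f0; have Z0 : 0 < Z by exact: Zconst_gt0.
have mp : measurable_fun setT p by exact: measurable_exp_power.
rewrite (@ge0_integral_density _ _ _ mu leb (fun x => Z^-1 * p x))//; last 2 first.
- by move=> x; rewrite mulr_ge0 ?expR_ge0// invr_ge0 ltW.
- exact: measurable_funM.
rewrite -ge0_integralZl//; last 3 first.
- by apply/measurable_EFinP/measurable_funM => //; exact: measurable_funM.
- by move=> x _; rewrite lee_fin !mulr_ge0 ?expR_ge0// invr_ge0 ltW.
- by rewrite lee_fin ltW.
by apply: eq_integral => x _; rewrite -EFinM mulrCA mulVKf// gt_eqF.
Qed.

Variables (w dw : R -> R -> R) (F dF B G : R -> R).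
Hypothesis is_derive_w : forall s x : R, is_derive x (1 : R) (w s) (dw s x).
Hypothesis continuous_dw : forall s, continuous (dw s).
Hypothesis is_derive_F : forall x : R, is_derive x (1 : R) F (dF x).
Hypothesis continuous_dF : continuous dF.
Hypothesis continuous_B : continuous B.
Hypothesis mG : measurable_fun setT G.
Hypothesis w_ge0 : forall s x, 0 <= s * x -> 0 <= w s x.
Hypothesis F_ge0 : forall x, 0 <= F x.
Hypothesis B_ge0 : forall x, 0 <= B x.
Hypothesis G_ge0 : forall x, 0 <= G x.
Hypothesis drift : forall s x, `|s| = 1 -> 0 <= s * x ->
  s * (dw s x * F x + w s x * dF x) + B x <=
  w s x * F x * (alpha * `|x| `^ (alpha - 1)) + G x.

Let Phi s x := w s x * F x * p x.
(** The derivative of [Phi s] on the half-line s x > 0 only; the formula is continuous everywhere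
    because alpha - 1 > 0. Since s^2 = 1, [drift] is the inequality on [s * dPhi s x] divided by
    [p x]. *)
Let dPhi s x := (dw s x * F x + w s x * dF x -
  w s x * F x * (s * (alpha * `|x| `^ (alpha - 1)))) * p x.

Let cp : continuous p. Proof. exact: continuous_exp_power. Qed.
Let cF : continuous F. Proof. exact: is_derive_continuous. Qed.
Let cw s : continuous (w s).
Proof. exact: is_derive_continuous (is_derive_w s). Qed.

Let cPhi s : continuous (Phi s).
Proof. by apply: continuous_funM => //; apply: continuous_funM. Qed.

Let cdPhi s : continuous (dPhi s).
Proof.
apply: continuous_funM => //; apply: continuous_funB.
  by apply: continuous_funD; apply: continuous_funM.
apply: continuous_funM; first exact: continuous_funM.
do 2 (apply: continuous_funM; first exact: cst_continuous).
by apply: continuous_norm_powR; rewrite subr_gt0.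
Qed.

Let cBp : continuous (fun x => B x * p x).
Proof. exact: continuous_funM. Qed.

Let mGp : measurable_fun setT (fun x => G x * p x).
Proof. by apply: measurable_funM => //; exact: measurable_exp_power. Qed.

Let p0 x : 0 <= p x. Proof. exact: exp_power_ge0. Qed.

Let Phi_ge0 (s x : R) : 0 <= s * x -> 0 <= Phi s x.
Proof. by move=> sx; rewrite !mulr_ge0// w_ge0. Qed.

Let dPhiE (s x : R) : `|s| = 1 -> 0 < s * x ->
  is_derive x (1 : R) (Phi s) (dPhi s x).
Proof.
move=> s1 sx; have dp := is_derive_exp_power alpha _ _ s1 sx.
have dwF : is_derive x (1 : R) (fun y => w s y * F y)
    (w s x * dF x + F x * dw s x) := is_deriveM (is_derive_w s x) (is_derive_F x).
have d : is_derive x (1 : R) (Phi s)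
    (w s x * F x * (- (s * (alpha * `|x| `^ (alpha - 1))) * p x) +
     p x * (w s x * dF x + F x * dw s x)) := is_deriveM dwF dp.
apply: (is_derive_eq d); rewrite /dPhi; ring.
Qed.

Let dPhi_le (s x : R) : `|s| = 1 -> 0 <= s * x ->
  s * dPhi s x + B x * p x <= G x * p x.
Proof.
move=> s1 sx; have s2 : s * s = 1.
  by rewrite -expr2 -real_normK ?num_real// s1 expr1n.
rewrite /dPhi mulrA -mulrDl; apply: ler_wpM2r => //.
have := drift s x s1 sx; rewrite -lerBlDl; apply: le_trans.
set V := alpha * _; rewrite mulrBr (_ : s * (w s x * F x * (s * V)) =
  (s * s) * (w s x * F x * V)); last by ring.
by rewrite s2 mul1r; lra.
Qed.

Lemma weighted_lyapunov_pointwise s x : `|s| = 1 -> 0 <= s * x ->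
  ((w s x * F x * p x)%:E <=
    (w s 0 * F 0)%:E + Z%:E * \int[mu]_z (G z)%:E)%E.
Proof.
move=> s1 sx; have := lyapunov_pointwise _ _ _ _ cPhi cdPhi cBp mGp _ _ dPhiE dPhi_le _ _ s1 sx.
rewrite integral_mu_alpha// /Phi /p exp_power0// mulr1; apply=> z;
  exact: mulr_ge0.
Qed.

Lemma weighted_lyapunov_integral :
  (Z%:E * \int[mu]_z (B z)%:E <= ((w 1 0 + w (-1) 0) * F 0)%:E +
    2%:E * (Z%:E * \int[mu]_z (G z)%:E))%E.
Proof.
have := lyapunov_integral _ _ _ _ cPhi cdPhi cBp mGp _ _ Phi_ge0 dPhiE dPhi_le.
rewrite !integral_mu_alpha//; last exact: continuous_measurable_fun.
rewrite /Phi /p exp_power0// !mulr1 -mulrDl; apply=> z; exact: mulr_ge0.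
Qed.

(** Without a boundary term at the origin the constant Z cancels. In the Poincare estimate [F]
    vanishes at 0, in the moment estimate the weight does. *)
Lemma weighted_lyapunov_centered : (w 1 0 + w (-1) 0) * F 0 = 0 ->
  (\int[mu]_z (B z)%:E <= 2%:E * \int[mu]_z (G z)%:E)%E.
Proof.
move=> wF0; have := weighted_lyapunov_integral; rewrite wF0 add0e.
have Z0 : 0 < Z by exact: Zconst_gt0.
by rewrite muleCA lee_pmul2l ?lte_fin.
Qed.

End weighted_lyapunov.

(** * Estimates in terms of the energy *)

Section energy.
Context {R : realType}.
Variable alpha : R.
Hypothesis alpha_gt1 : 1 < alpha.
Hypothesis alpha_le2 : alpha <= 2.
Let beta := conj_exp alpha.
Let beta_ge2 : 2 <= beta. Proof. exact: conj_exp_ge2. Qed.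

(** For |x| <= 1 this is beta / 2 >= 1; beyond 1, beta H is at least |x|^beta, hence at least x^2.
    This bound serves the Poincare and pointwise estimates, the next one Young's inequality. *)
Lemma Hfun_ge_sqr (x : R) : x ^+ 2 <= beta * Hfun 1 alpha x.
Proof.
have b2 := beta_ge2.
rewrite /Hfun -/beta; case: ifPn => [_|].
  by rewrite mulrCA ler_peMr ?sqr_ge0// ler_pdivlMr// mul1r.
rewrite -ltNge => x1; rewrite powR1 mul1r expr1n mul1r mulrDr.
rewrite mulrCA divff ?mulr1; last by rewrite gt_eqF// (lt_le_trans _ b2).
apply: (@le_trans _ _ (`|x| `^ beta)).
  rewrite -[leLHS]real_normK ?num_real// -powR_mulrn//.
  by apply: ler_powR => //; exact: ltW.
by rewrite lerDl mulr_ge0 ?divr_ge0//; lra.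
Qed.

Lemma Hfun_ge_powR (x : R) : `|x| `^ beta <= beta * Hfun 1 alpha x.
Proof.
have b2 := beta_ge2.
have [x1|x1] := leP `|x| 1.
  apply: le_trans (Hfun_ge_sqr x).
  rewrite -[leRHS]real_normK ?num_real// -powR_mulrn//.
  have [->|x0] := eqVneq `|x| 0; first by rewrite !powR0//; lra.
  by apply: ger_powR => //; rewrite lt_neqAle eq_sym x0 normr_ge0.
rewrite /Hfun (lt_geF x1) powR1 mul1r expr1n mul1r mulrDr -/beta.
rewrite mulrCA divff ?mulr1; last by rewrite gt_eqF// (lt_le_trans _ b2).
by rewrite lerDl mulr_ge0 ?divr_ge0//; lra.
Qed.

Lemma Hfun_ge0 (x : R) : 0 <= Hfun 1 alpha x.
Proof.
have b2 := beta_ge2.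
have b0 : 0 < beta by lra.
rewrite -(pmulr_rge0 _ b0).
by rewrite (le_trans _ (Hfun_ge_sqr x))// sqr_ge0.
Qed.

Lemma measurable_Hfun : measurable_fun setT (Hfun 1 alpha).
Proof.
have mn : measurable_fun setT (fun x : R => `|x|) by [].
apply: measurable_fun_ifT.
- exact: measurable_fun_ler.
- by apply: measurable_funM => //; exact: measurable_funX.
- apply: measurable_funD => //; apply: measurable_funM => //.
  apply: measurable_funM => //.
  exact: (@measurableT_comp _ _ _ _ _ _ (@powR R ^~ beta)).
Qed.

(** The real-valued integrand H(f'/f) f^2. The value 0 at a zero of f agrees with +oo * 0 = 0 in
    [LSI]. *)
Definition energy (f df : R -> R) (x : R) : R :=
  if f x == 0 then 0 else Hfun 1 alpha (df x / f x) * f x ^+ 2.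

Variables f df : R -> R.

Lemma energy_ge0 x : 0 <= energy f df x.
Proof. by rewrite /energy; case: ifP => // _; rewrite mulr_ge0 ?sqr_ge0 ?Hfun_ge0. Qed.

(** The factor f^2 on both sides matters: at a simple zero of f the energy density is 0 while f' is
    not, so a bound on f'^2 alone would fail. *)
Lemma energy_ge_sqr x : (f x * df x) ^+ 2 <= beta * energy f df x * f x ^+ 2.
Proof.
rewrite /energy; case: ifPn => [/eqP ->|f0]; first by rewrite !(mul0r, mulr0, expr0n).
rewrite [leLHS](_ : _ = (df x / f x) ^+ 2 * f x ^+ 2 * f x ^+ 2); last by field.
rewrite !ler_wpM2r ?sqr_ge0// mulrA ler_wpM2r ?sqr_ge0//; exact: Hfun_ge_sqr.
Qed.

Lemma energy_ge_powR x : f x != 0 ->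
  `|df x / f x| `^ beta * f x ^+ 2 <= beta * energy f df x.
Proof.
move=> f0; rewrite /energy (negPf f0) mulrA ler_wpM2r ?sqr_ge0//.
exact: Hfun_ge_powR.
Qed.

Lemma measurable_energy : measurable_fun setT f -> measurable_fun setT df ->
  measurable_fun setT (energy f df).
Proof.
move=> mf mdf; apply: measurable_fun_ifT => //.
- exact: measurable_fun_eqr.
- apply: measurable_funM; last exact: measurable_funX.
  apply: measurableT_comp; first exact: measurable_Hfun.
  apply: measurable_funM => //.
  (* Expresses the inverse through the measurable function [powR]; at a zero of f both sides are
     0. *)
  have -> : (fun x => (f x)^-1) = (fun x => f x * (`|f x| `^ (-1)) ^+ 2).
    apply/funext => x; rewrite powR_inv1// exprVn real_normK ?num_real//.
    by have [->|f0] := eqVneq (f x) 0; [rewrite invr0 mul0r|field].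
  apply: measurable_funM => //; apply: measurable_funX.
  apply: (@measurableT_comp _ _ _ _ _ _ (@powR R ^~ (-1))) => //.
  exact: measurableT_comp.
Qed.

End energy.

(** * Poincare, pointwise and weighted moment estimates *)

Section energy_estimates.
Context {R : realType}.
Variable alpha : R.
Hypothesis alpha_gt1 : 1 < alpha.
Hypothesis alpha_le2 : alpha <= 2.
Let beta := conj_exp alpha.
Let mu := mu_alpha alpha_gt1.
Variables f df : R -> R.
Hypothesis is_derive_f : forall x : R, is_derive x (1 : R) f (df x).
Hypothesis continuous_df : continuous df.
Let G := energy alpha f df.

Let beta_ge2 : 2 <= beta. Proof. exact: conj_exp_ge2. Qed.
Let beta_ge0 : 0 <= beta. Proof. exact: le_trans beta_ge2. Qed.
Let G_ge0 x : 0 <= G x. Proof. exact: energy_ge0. Qed.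
Let cf : continuous f. Proof. exact: is_derive_continuous. Qed.
Let mG : measurable_fun setT G.
Proof.
by apply: measurable_energy => //; exact: continuous_measurable_fun.
Qed.

Let is_derive_sqr (x : R) :
  is_derive x (1 : R) (fun y => 1 + f y ^+ 2) (2 * (f x * df x)).
Proof.
have d1 : is_derive x (1 : R) (fun y => f y ^+ 2) _ := is_derive_funX _ 2 _ _ (is_derive_f x).
have d2 : is_derive x (1 : R) (fun y => 1 + f y ^+ 2) _ :=
  is_deriveD (is_derive_cst (1 : R) x (1 : R)) d1.
apply: (is_derive_eq d2).
by rewrite add0r /= expr1 mulrA.
Qed.

Let sqr1_gt0 x : 0 < 1 + f x ^+ 2.
Proof. by rewrite ltr_pwDl// sqr_ge0. Qed.

Let csqr1 : continuous (fun x => 1 + f x ^+ 2).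
Proof. by apply: continuous_funD; [exact: cst_continuous|exact: continuous_funX]. Qed.

Let k x : R := Num.sqrt (1 + f x ^+ 2).

Let k_gt0 x : 0 < k x. Proof. by rewrite sqrtr_gt0. Qed.

Let k_sqr x : k x ^+ 2 = 1 + f x ^+ 2. Proof. by rewrite sqr_sqrtr// ltW. Qed.

Let is_derive_k (x : R) : is_derive x (1 : R) k (f x * df x / k x).
Proof.
have d1 : is_derive x (1 : R) k _ :=
  is_derive_fun_comp (fun y => 1 + f y ^+ 2) Num.sqrt x _ _
    (is_derive1_sqrt (sqr1_gt0 x)) (is_derive_sqr x).
apply: (is_derive_eq d1).
have kn0 : k x != 0 by rewrite gt_eqF.
by rewrite -/(k x); field.
Qed.

Let ck : continuous k. Proof. exact: (is_derive_continuous _ _ is_derive_k). Qed.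

Let cff : continuous (fun x => f x * df x).
Proof. exact: continuous_funM. Qed.

(** The factor f^2 of [energy_ge_sqr] is at most k^2, the denominator of k'^2. *)
Let dk_le x : (f x * df x / k x) ^+ 2 <= beta * G x.
Proof.
rewrite expr_div_n k_sqr ler_pdivrMr// (le_trans (energy_ge_sqr _ alpha_gt1 alpha_le2 _ _ _))//.
by rewrite ler_wpM2l ?lerDr ?mulr_ge0.
Qed.

(** Near the origin the decrease of the weight yields a multiple of F = (k - k(0))^2, and far from
    it the slope of |x|^alpha does. The cross term with k' is split between F and the energy. *)
Lemma poincare_sqrt :
  (\int[mu]_x ((k x - k 0) ^+ 2)%:E <=
   (32 * expR 1 ^+ 2 * beta)%:E * \int[mu]_x (G x)%:E)%E.
Proof.
pose e : R := expR 1.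
have e1 : 1 <= e by rewrite /e -expR0 ler_expR.
have e0 : 0 <= e := le_trans ler01 e1.
(* The factor 2 e makes 2 F available: one copy of F is the integrand to be bounded, the other
   absorbs the cross term. *)
pose w (s x : R) : R := 2 * e * (1 + expR (- (s * x))).
pose dw (s x : R) : R := 2 * e * (- s * expR (- (s * x))).
pose F x := (k x - k 0) ^+ 2.
pose dF x := 2 * (k x - k 0) * (f x * df x / k x).
have cexp (s : R) : continuous (fun x : R => expR (- (s * x))).
  move=> x; apply: continuous_comp; last exact: continuous_expR.
  apply: continuousN; apply: (@continuous_funM _ (fun=> s) id).
    exact: cst_continuous.
  by move=> y; exact: cvg_id.

(* The split-off 2 is the factor in [weighted_lyapunov_centered]. *)
have -> : (32 * expR 1 ^+ 2 * beta)%:E = (2%:E * (16 * e ^+ 2 * beta)%:E)%E.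
  by rewrite /e -EFinM; congr (_%:E); ring.
rewrite -muleA -ge0_integralZl//; last 3 first.
- exact/measurable_EFinP.
- by move=> x _; rewrite lee_fin.
- by rewrite lee_fin !mulr_ge0 ?sqr_ge0//.
apply: (@weighted_lyapunov_centered _ _ _ w dw F dF F (fun x => 16 * e ^+ 2 * beta * G x)).
- move=> s x; have d1 : is_derive x (1 : R) (fun y : R => - (s * y)) (- s).
    have := is_deriveN (is_deriveZ s (is_derive_id x (1 : R))).
    by rewrite /GRing.scale/= mulr1.
  have d2 : is_derive x (1 : R) (fun y => expR (- (s * y))) _ :=
    is_derive_fun_comp _ expR x _ _ (is_derive_expR _) d1.
  have d3 : is_derive x (1 : R) (w s) _ :=
    is_deriveZ (2 * e) (is_deriveD (is_derive_cst (1 : R) x (1 : R)) d2).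
  by apply: (is_derive_eq d3); rewrite /dw add0r /GRing.scale/=; ring.
- move=> s; apply: continuous_funM; first exact: cst_continuous.
  by apply: continuous_funM => //; exact: cst_continuous.
- move=> x.
  have d1 : is_derive x (1 : R) (fun y => k y - k 0) _ :=
    is_deriveB (is_derive_k x) (is_derive_cst (k 0) x 1).
  have d2 : is_derive x (1 : R) F _ := is_derive_funX _ 2 _ _ d1.
  by apply: (is_derive_eq d2); rewrite /dF subr0 /= expr1.
- apply: continuous_funM.
    apply: continuous_funM; first exact: cst_continuous.
    by apply: continuous_funB => //; exact: cst_continuous.
  apply: continuous_funM => //; apply: continuous_funV => // x.
  by rewrite gt_eqF.
- apply: continuous_funX; apply: continuous_funB => //; exact: cst_continuous.
- by apply: measurable_funM.
- by move=> s x _; rewrite !mulr_ge0 ?addr_ge0 ?expR_ge0// (le_trans _ e1).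
- by move=> x; exact: sqr_ge0.
- by move=> x; exact: sqr_ge0.
- by move=> x; rewrite !mulr_ge0 ?sqr_ge0//.
- move=> s x s1 sx.
  have xE : `|x| = s * x by rewrite -[LHS]mul1r -s1 -normrM ger0_norm.
  have s2 : s * s = 1 by rewrite -expr2 -real_normK ?num_real// s1 expr1n.
  set y := f x * df x / k x; set t := k x - k 0; set E := expR (- (s * x)).
  have y2 : y ^+ 2 <= beta * G x := dk_le x.
  set V := alpha * _.
  have V0 : 0 <= V by rewrite mulr_ge0 ?powR_ge0// ltW// (lt_trans ltr01).
  have E0 : 0 <= E by exact: expR_ge0.
  have E1 : E <= 1 by rewrite /E -expR0 ler_expR oppr_le0.
  (* [V] is here the slope alpha |x|^(alpha - 1). For |x| <= 1, e E >= 1; for |x| > 1, V >= 1. *)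
  have EV : 1 <= e * (E + (1 + E) * V).
    have [x1|x1] := leP (s * x) 1.
      have h1 : 1 <= e * E by rewrite -expRD -[leLHS]expR0 ler_expR subr_ge0.
      have h2 := mulr_ge0 e0 (mulr_ge0 (addr_ge0 ler01 E0) V0).
      by rewrite mulrDr; lra.
    rewrite -[leLHS]mulr1 ler_pM// ler_wpDl//.
    have V1 : 1 <= V.
      have xp : 1 <= `|x| `^ (alpha - 1).
        rewrite xE -[leLHS](powRr0 (s * x)); apply: ler_powR; first exact: ltW.
        by rewrite subr_ge0 ltW.
      by rewrite -[leLHS]mulr1; apply: ler_pM => //; exact: ltW.
    by rewrite -[leLHS]mulr1 ler_pM// lerDl.
  have st : s * (2 * t * y) <= `|2 * t * y|.
    by rewrite (le_trans (ler_norm _))// normrM s1 mul1r.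
  have wst : w s x * (s * (2 * t * y)) <= 4 * e * `|2 * t * y|.
    apply: (@le_trans _ _ (w s x * `|2 * t * y|)).
      by rewrite ler_wpM2l// /w -/E !mulr_ge0 ?addr_ge0//; lra.
    rewrite ler_wpM2r// /w -/E.
    have E2 : 0 <= 1 - E by rewrite subr_ge0.
    by have := mulr_ge0 e0 E2; lra.
  (* Expanding the square of |t| - 4 e |y|; this fixes the constant 16 e^2. *)
  have am : 4 * e * `|2 * t * y| <= t ^+ 2 + 16 * e ^+ 2 * y ^+ 2.
    rewrite normrM [`|2 * t|]normrM normr_nat -(real_normK (num_real t)) -(real_normK (num_real y)).
    by have := sqr_ge0 (`|t| - 4 * e * `|y|); lra.
  have e2y : 16 * e ^+ 2 * y ^+ 2 <= 16 * e ^+ 2 * (beta * G x).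
    by rewrite ler_wpM2l// mulr_ge0 ?sqr_ge0.
  have tEV : t ^+ 2 <= e * (E + (1 + E) * V) * t ^+ 2 by rewrite ler_peMl ?sqr_ge0.
  have -> : s * (dw s x * F x + w s x * dF x) + F x =
      - (2 * e * E * t ^+ 2) * (s * s) + w s x * (s * (2 * t * y)) + t ^+ 2.
    by rewrite /dw /F /dF -/t -/y -/E; ring.
  have -> : w s x * F x * V + 16 * e ^+ 2 * beta * G x =
    2 * (e * (E + (1 + E) * V) * t ^+ 2) - 2 * e * E * t ^+ 2 +
    16 * e ^+ 2 * (beta * G x).
    by rewrite /w /F -/t -/E; ring.
  rewrite s2 mulr1; lra.
- by rewrite /F subrr expr0n mulr0.
Qed.


(** With constant weight and zero left integrand, the slope of |x|^alpha only helps and is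
    discarded; it remains to bound 2 f f' by f^2 + beta G. *)
Lemma exp_power_sup_bound x :
  ((f x ^+ 2 * exp_power alpha x)%:E <= (f 0 ^+ 2)%:E +
    (Zconst alpha)%:E * \int[mu]_z (f z ^+ 2 + beta * G z)%:E)%E.
Proof.
pose s : R := if 0 <= x then 1 else -1.
have s1 : `|s| = 1 by rewrite /s; case: ifP => _; rewrite ?normrN1 ?normr1.
have sx : 0 <= s * x.
  by rewrite /s; case: (leP 0 x) => x0; rewrite ?mul1r// mulN1r oppr_ge0 ltW.
suff : ((1 * f x ^+ 2 * exp_power alpha x)%:E <= (1 * f 0 ^+ 2)%:E +
    (Zconst alpha)%:E * \int[mu]_z (f z ^+ 2 + beta * G z)%:E)%E.
  by rewrite !mul1r.
apply: (@weighted_lyapunov_pointwise _ _ alpha_gt1 (fun _ _ => 1) (fun _ _ => 0)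
  (fun y => f y ^+ 2) (fun y => 2 * (f y * df y)) (fun=> 0)
  (fun y => f y ^+ 2 + beta * G y) _ _ _ _ _ _ _ _ _ s) => //.
- by move=> ?; exact: cst_continuous.
- move=> y; apply: (is_derive_eq (is_derive_funX _ 2 _ _ (is_derive_f y))).
  by rewrite /= expr1 mulrA.
- by apply: continuous_funM => //; exact: cst_continuous.
- exact: cst_continuous.
- apply: measurable_funD.
    by apply: measurable_funX; exact: continuous_measurable_fun.
  exact: measurable_funM.
- by move=> y; rewrite addr_ge0 ?sqr_ge0// mulr_ge0.
- move=> {s x s1 sx} s x s1 sx.
  rewrite mul0r add0r mul1r addr0 mul1r; set V := alpha * _.
  have V0 : 0 <= V by rewrite mulr_ge0 ?powR_ge0// ltW// (lt_trans ltr01).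
  have fV : 0 <= f x ^+ 2 * V by rewrite mulr_ge0 ?sqr_ge0.
  have bG : 0 <= beta * G x by rewrite mulr_ge0.
  have y2 : (f x * df x) ^+ 2 <= beta * G x * f x ^+ 2 by exact: energy_ge_sqr.
  (* After squaring, [energy_ge_sqr] reduces this to 4 a b <= (a + b)^2 with a = f^2 and b = beta G,
     which avoids dividing by f. *)
  have am : `|s * (2 * (f x * df x))| <= f x ^+ 2 + beta * G x.
    rewrite -(@ler_pXn2r _ 2)// ?nnegrE ?normr_ge0 ?addr_ge0 ?sqr_ge0//.
    rewrite normrM s1 mul1r real_normK ?num_real// exprMn.
    by have := sqr_ge0 (f x ^+ 2 - beta * G x); lra.
  by have := ler_norm (s * (2 * (f x * df x))); lra.
Qed.

Variable j : nat.
(** Even, so that q^n >= 0, and at least 2, so that Psi <= Q. The condition [n_large] amounts to n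
    >= beta. *)
Let n := j.*2.+2.
Hypothesis n_large : n%:R <= n.-1%:R * alpha.

(** This is (u - 1) / (u + 1) with u = f^2. *)
Let q x : R := 1 - 2 * (1 + f x ^+ 2)^-1.
Let Psi x : R := (1 + f x ^+ 2) * q x ^+ n.

Let sqr1_neq0 x : 1 + f x ^+ 2 != 0. Proof. by rewrite gt_eqF. Qed.

Let is_derive_q (x : R) :
  is_derive x (1 : R) q (4 * (f x * df x) / (1 + f x ^+ 2) ^+ 2).
Proof.
have d1 : is_derive x (1 : R) (fun y => (1 + f y ^+ 2)^-1) _ :=
  @is_deriveV _ (fun y => 1 + f y ^+ 2) _ _ _ (sqr1_neq0 x) (is_derive_sqr x).
have d2 : is_derive x (1 : R) q _ :=
  is_deriveB (is_derive_cst (1 : R) x (1 : R)) (is_deriveZ (2 : R) d1).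
apply: (is_derive_eq d2); rewrite /GRing.scale/=.
have := sqr1_neq0 x; set v := 1 + _ => v0.
by field.
Qed.

Let dPsi x : R := 2 * (f x * df x) *
  (q x ^+ n + 2 * n%:R * q x ^+ n.-1 / (1 + f x ^+ 2)).

Let is_derive_Psi (x : R) : is_derive x (1 : R) Psi (dPsi x).
Proof.
have d1 := is_derive_funM _ _ _ _ _ (is_derive_sqr x)
  (is_derive_funX _ n _ _ (is_derive_q x)).
apply: (is_derive_eq d1); rewrite /dPsi.
have := sqr1_neq0 x; set v := 1 + _ => v0.
by field.
Qed.

Let norm_q x : `|q x| <= 1.
Proof.
rewrite ler_norml /q; have v0 := sqr1_gt0 x.
have v1 : (1 + f x ^+ 2)^-1 <= 1 by rewrite invf_le1// lerDl sqr_ge0.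
have v2 : 0 < (1 + f x ^+ 2)^-1 by rewrite invr_gt0.
by apply/andP; split; lra.
Qed.

Let q_ge0 x : 0 <= q x ^+ n.
Proof. by rewrite exprn_even_ge0//= negbK odd_double. Qed.

Let Psi_ge0 x : 0 <= Psi x. Proof. by rewrite mulr_ge0// ltW. Qed.

(** Both terms of Psi' contain q^(n-1), and the remaining factors |q| and 1 / (1 + f^2) are at most
    1. *)
Let norm_dPsi x :
  `|dPsi x| <= 2 * (1 + 2 * n%:R) * (`|f x * df x| * `|q x| ^+ n.-1).
Proof.
have v1 : (1 + f x ^+ 2)^-1 <= 1 by rewrite invf_le1// lerDl sqr_ge0.
have v0 : 0 <= (1 + f x ^+ 2)^-1 by rewrite invr_ge0 ltW.
rewrite /dPsi; set y := f x * df x.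
rewrite normrM (normrM 2) normr_nat -!mulrA ler_wpM2l//.
rewrite [leRHS]mulrCA ler_wpM2l// (le_trans (ler_normD _ _))// [leRHS]mulrDl mul1r.
have qn : `|q x| ^+ n <= `|q x| ^+ n.-1 by rewrite exprS ler_piMl.
rewrite normrX lerD// !normrM normrX ger0_norm// [`|n%:R|]ger0_norm//.
rewrite (ger0_norm v0) -!mulrA ler_wpM2l// ler_wpM2l// ler_piMr// exprn_ge0.
Qed.

(** Twice the constant of [norm_dPsi], on account of the weight 2 |x|. *)
Let K : R := 4 * (1 + 2 * n%:R).

(* Young's inequality with the conjugate exponents alpha and beta absorbs the
   cross term into |x|^alpha Psi. *)
Let norm_dPsi_young x :
  2 * (`|x| * `|dPsi x|) <= `|x| `^ alpha * Psi x + K `^ beta * G x.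
Proof.
have a0 : 0 < alpha by exact: lt_trans alpha_gt1.
have b0 : 0 < beta by exact: lt_le_trans beta_ge2.
have K0 : 0 <= K by rewrite mulr_ge0// addr_ge0// mulr_ge0.
have [f0|f0] := eqVneq (f x) 0.
  rewrite /dPsi f0 mul0r mulr0 mul0r normr0 !mulr0.
  exact: addr_ge0 (mulr_ge0 (powR_ge0 _ _) (Psi_ge0 x))
    (mulr_ge0 (powR_ge0 _ _) (G_ge0 x)).
(* All powers of q go with |x|: by [n_large], |q|^((n-1) alpha) <= q^n, so X^alpha is controlled by
   |x|^alpha q^n. The quotient f'/f goes into Y, and Y^beta f^2 is paid by the energy. *)
pose X := `|x| * `|q x| ^+ n.-1.
pose Y := K * `|df x / f x|.
have X0 : 0 <= X by rewrite mulr_ge0 ?exprn_ge0.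
have Y0 : 0 <= Y by rewrite mulr_ge0.
have XY := conjugate_powR X0 Y0 a0 b0 (conj_exp_eq1 alpha_gt1).
have Xle : X `^ alpha / alpha <= `|x| `^ alpha * q x ^+ n.
  apply: (@le_trans _ _ (X `^ alpha)).
    by rewrite ler_piMr ?powR_ge0// invf_le1// ltW.
  rewrite powRM ?exprn_ge0// ler_wpM2l ?powR_ge0//.
  rewrite -(ger0_norm (q_ge0 x)) normrX -!powR_mulrn// -powRrM.
  have [->|q0] := eqVneq `|q x| 0.
    by rewrite !powR0 ?mulf_neq0 ?pnatr_eq0 ?gt_eqF.
  by apply: ger_powR => //; rewrite lt_neqAle eq_sym q0 normr_ge0 norm_q.
have Yle : Y `^ beta / beta * f x ^+ 2 <= K `^ beta * G x.
  rewrite powRM// -!mulrA ler_wpM2l ?powR_ge0// mulrCA mulrC ler_pdivrMr//.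
  by rewrite [leRHS]mulrC; exact: energy_ge_powR.
have main : 2 * (`|x| * `|dPsi x|) <= X * Y * f x ^+ 2.
  rewrite (_ : X * Y * f x ^+ 2 = 2 * (`|x| * (2 * (1 + 2 * n%:R) *
    (`|f x * df x| * `|q x| ^+ n.-1)))); last first.
    rewrite /X /Y /K -[f x ^+ 2]real_normK ?num_real// !normrM normfV.
    have : `|f x| != 0 by rewrite normr_eq0.
    by move=> ?; field.
  by rewrite ler_wpM2l// ler_wpM2l.
apply: (le_trans main); apply: (@le_trans _ _
    ((X `^ alpha / alpha + Y `^ beta / beta) * f x ^+ 2)).
  by rewrite ler_wpM2r ?sqr_ge0.
rewrite mulrDl lerD//.
apply: (@le_trans _ _ (`|x| `^ alpha * q x ^+ n * f x ^+ 2)).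
  by rewrite ler_wpM2r ?sqr_ge0.
by rewrite -mulrA ler_wpM2l ?powR_ge0// mulrC ler_wpM2r// lerDr.
Qed.

(** The weight 2 |x| times the slope alpha |x|^(alpha - 1) gives 2 alpha |x|^alpha. As alpha > 1
    this covers two copies of |x|^alpha Psi: the integrand itself and the one spent in Young's
    inequality. The derivative of the weight leaves 2 Psi. *)
Lemma weighted_moment :
  (\int[mu]_x (`|x| `^ alpha * Psi x)%:E <=
   2%:E * \int[mu]_x (2 * Psi x + K `^ beta * G x)%:E)%E.
Proof.
have a0 : 0 < alpha by exact: lt_trans alpha_gt1.
have cq : continuous q.
  exact: (is_derive_continuous _ _ is_derive_q).
have cPsi : continuous Psi by exact: (is_derive_continuous _ _ is_derive_Psi).
apply: (@weighted_lyapunov_centered _ _ _ (fun s x => 2 * (s * x))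
  (fun s _ => 2 * s) Psi dPsi).
- move=> s x.
  have d : is_derive x (1 : R) (fun y => 2 * (s * y)) _ :=
    is_deriveZ (2 : R) (is_deriveZ s (is_derive_id x (1 : R))).
  by apply: (is_derive_eq d); rewrite /GRing.scale/= mulr1.
- by move=> s; exact: cst_continuous.
- exact: is_derive_Psi.
- apply: continuous_funM.
    by apply: continuous_funM => //; exact: cst_continuous.
  apply: continuous_funD; first exact: continuous_funX.
  apply: continuous_funM; last exact: continuous_funV.
  apply: continuous_funM; last exact: continuous_funX.
  exact: cst_continuous.
- by apply: continuous_funM => //; exact: continuous_norm_powR.
- apply: measurable_funD; apply: measurable_funM => //.
  exact: continuous_measurable_fun.
- by move=> s x sx; rewrite mulr_ge0.
- exact: Psi_ge0.
- by move=> x; rewrite mulr_ge0 ?powR_ge0.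
- move=> x; apply: addr_ge0; apply: mulr_ge0 => //; exact: powR_ge0.
- move=> s x s1 sx.
  have s2 : s * s = 1 by rewrite -expr2 -real_normK ?num_real// s1 expr1n.
  have xE : `|x| = s * x by rewrite -[LHS]mul1r -s1 -normrM ger0_norm.
  have -> : s * (2 * s * Psi x + 2 * (s * x) * dPsi x) =
    (s * s) * (2 * Psi x + 2 * (x * dPsi x)) by ring.
  have -> : 2 * (s * x) * Psi x * (alpha * `|x| `^ (alpha - 1)) =
      2 * alpha * (`|x| `^ alpha * Psi x).
    by rewrite -xE -(@mulr_powRB1 _ `|x| alpha)//; ring.
  rewrite s2 mul1r.
  have yg := norm_dPsi_young x.
  have := ler_norm (x * dPsi x); rewrite normrM => nx.
  set A := `|x| `^ alpha * Psi x.
  have A0 : 0 <= A by rewrite mulr_ge0 ?powR_ge0.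
  have : A <= alpha * A by rewrite ler_peMl// ltW.
  by move: yg; rewrite -/A; lra.
- by rewrite !mulr0 addr0 mul0r.
Qed.

End energy_estimates.

(** * Entropy *)

Section probability_integral.
Context {d : measure_display} {T : measurableType d} {R : realType}.
Variable P : probability T R.
Implicit Types g h : T -> R.

Definition L1 g := P.-integrable [set: T] (EFin \o g).
Definition expect g : R := \int[P]_x g x.

Lemma expectE g : L1 g -> (\int[P]_x (g x)%:E = (expect g)%:E)%E.
Proof. by move=> ig; rewrite /expect /Rintegral fineK// integrable_fin_num. Qed.

Lemma L1D g h : L1 g -> L1 h -> L1 (fun x => g x + h x).
Proof. by move=> ig ih; exact: (integrableD measurableT ig ih). Qed.

Lemma expectD g h : L1 g -> L1 h ->
  expect (fun x => g x + h x) = expect g + expect h.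
Proof. exact: RintegralD. Qed.

Lemma L1Z (c : R) g : L1 g -> L1 (fun x => c * g x).
Proof. by move=> ig; exact: (integrableZl measurableT c ig). Qed.

Lemma expectZ (c : R) g : L1 g -> expect (fun x => c * g x) = c * expect g.
Proof. exact: RintegralZl. Qed.

Lemma L1_cst (c : R) : L1 (fun=> c).
Proof. exact: finite_measure_integrable_cst. Qed.

Lemma expect_cst (c : R) : expect (fun=> c) = c.
Proof. by rewrite /expect Rintegral_cst//= probability_setT mulr1. Qed.

Lemma ge0_L1 g : measurable_fun setT g -> (forall x, 0 <= g x) ->
  (\int[P]_x (g x)%:E < +oo)%E -> L1 g.
Proof.
move=> mg g0 goo; apply/integrableP; split; first exact/measurable_EFinP.
by under eq_integral do rewrite /= ger0_norm//.
Qed.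

Lemma L1_le g h : measurable_fun setT g -> L1 h ->
  (forall x, `|g x| <= h x) -> L1 g.
Proof.
move=> mg ih gh; apply: le_integrable ih => //; first exact/measurable_EFinP.
by move=> x _ /=; rewrite lee_fin (le_trans (gh x))// ler_norm.
Qed.

Lemma expect_le g h : L1 g -> L1 h -> (forall x, g x <= h x) ->
  expect g <= expect h.
Proof. by move=> ig ih gh; apply: le_Rintegral. Qed.

Lemma expect_ge0 g : (forall x, 0 <= g x) -> 0 <= expect g.
Proof. by move=> g0; apply: Rintegral_ge0. Qed.

Lemma expect_sqrB g (c : R) : L1 g -> L1 (fun x => g x ^+ 2) ->
  L1 (fun x => (g x - c) ^+ 2) /\
  expect (fun x => (g x - c) ^+ 2) =
    expect (fun x => g x ^+ 2) - 2 * c * expect g + c ^+ 2.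
Proof.
move=> ig ig2.
have -> : (fun x => (g x - c) ^+ 2) =
    (fun x => (g x ^+ 2 + (- (2 * c)) * g x) + c ^+ 2).
  by apply/funext => x; ring.
have i1 := L1Z (- (2 * c)) _ ig.
have i2 := L1D _ _ ig2 i1.
split; first exact: (L1D _ _ i2 (L1_cst _)).
rewrite (expectD _ _ i2 (L1_cst _)) (expectD _ _ ig2 i1) expectZ// expect_cst.
by rewrite mulNr.
Qed.

(** Let A be the mean of g. The left side is 2 a (a - A), the variance a^2 - A^2 is at most the mean
    of (g - c)^2, and a (a - A) <= a^2 - A^2 because 0 <= A <= a. *)
Lemma expect_sqrB_norm g (a c : R) : 0 < a -> (forall x, 0 <= g x) -> L1 g ->
  L1 (fun x => g x ^+ 2) -> expect (fun x => g x ^+ 2) = a ^+ 2 ->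
  expect (fun x => (g x - a) ^+ 2) <= 2 * expect (fun x => (g x - c) ^+ 2).
Proof.
move=> a0 g0 ig ig2 ea.
have [_ Ea] := expect_sqrB _ a ig ig2; have [_ Ec] := expect_sqrB _ c ig ig2.
have : 0 <= expect (fun x => (g x - a) ^+ 2).
  by apply: expect_ge0 => x; exact: sqr_ge0.
have := expect_ge0 _ g0; rewrite Ea Ec ea; set A := expect g => A0 h.
have aA : A <= a by rewrite -(ler_pM2l a0); lra.
have := sqr_ge0 (c - A); have : 0 <= A * (a - A) by rewrite mulr_ge0// subr_ge0.
lra.
Qed.

End probability_integral.

(** * Pointwise bounds on u ln u *)

Section entropy_pointwise.
Context {R : realType}.

Lemma mulr_ln_ge (u : R) : 0 <= u -> u - 1 <= u * ln u.
Proof.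
rewrite le_eqVlt => /predU1P[<-|u0]; first by rewrite mul0r sub0r lerN10.
have : ln u^-1 <= u^-1 - 1.
  have := @le_ln1Dx R (u^-1 - 1); rewrite (addrC 1) subrK; apply.
  by rewrite ltrBrDr addNr invr_gt0.
rewrite lnV ?posrE// => h; have := ler_wpM2l (ltW u0) h.
by rewrite mulrBr divff ?gt_eqF// mulr1 mulrN; lra.
Qed.

(** If u <= 4, then u ln u <= u (u - 1) = (u - 1) + (1 + u) Q and 1 + u <= 5. If u > 4, then u <= 3
    Q and q >= 3/5, which explains the constants 3 and 5/3. *)
Lemma entropy_pointwise (u V D0 D1 : R) (n : nat) : ~~ odd n ->
  0 <= u -> 0 <= V -> 0 <= D0 -> 0 <= D1 ->
  u * expR (- V) <= D0 + D1 ->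
  u * ln u <= (u - 1) + (5 + 3 * D0) * ((u - 1) ^+ 2 / (1 + u)) +
    (5 / 3) ^+ n * (V * ((1 + u) * (1 - 2 * (1 + u)^-1) ^+ n)) + D1 * u.
Proof.
move=> n_even u0 V0 D00 D10 u_le.
set Q := (u - 1) ^+ 2 / (1 + u); set q := 1 - 2 * _.
have u1 : 0 < 1 + u by rewrite ltr_pwDl.
have Q0 : 0 <= Q by rewrite divr_ge0 ?sqr_ge0// ltW.
have qn0 : 0 <= q ^+ n by rewrite exprn_even_ge0// n_even.
have W0 : 0 <= (5 / 3) ^+ n * (V * ((1 + u) * q ^+ n)).
  by rewrite mulr_ge0 ?exprn_ge0 ?divr_ge0// mulr_ge0// mulr_ge0// ltW.
have D1u : 0 <= D1 * u by rewrite mulr_ge0.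
have D0Q : 0 <= D0 * Q by rewrite mulr_ge0.
have u1n : 1 + u != 0 by rewrite gt_eqF.
have QE : (u - 1) ^+ 2 = (1 + u) * Q by rewrite /Q; field.
have [u4|u4] := leP u 4.
  have lnu : u * ln u <= u * (u - 1).
    move: u0; rewrite le_eqVlt => /predU1P[<-|u0]; first by rewrite !mul0r.
    rewrite ler_pM2l//; have := @le_ln1Dx R (u - 1); rewrite (addrC 1) subrK; apply.
    by rewrite ltrBrDr addNr.
  have uQ : (1 + u) * Q <= 5 * Q by rewrite ler_wpM2r//; lra.
  by move: QE; rewrite expr2; lra.
have up : 0 < u by lra.
(* Write u = e^V (u e^(-V)) and use ln t < t for the second factor. *)
have lnu : ln u <= V + (D0 + D1).
  have -> : ln u = V + ln (u * expR (- V)).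
    by rewrite lnM ?posrE ?expR_gt0// expRK; ring.
  rewrite lerD2l (le_trans _ u_le)// ltW// ln_sublinear// mulr_gt0//.
  exact: expR_gt0.
have uQ : u <= 3 * Q.
  rewrite /Q mulrA ler_pdivlMr//.
  have : 0 <= (2 * u - 1) * (u - 3) by rewrite mulr_ge0//; lra.
  rewrite expr2; lra.
have D0uQ : D0 * u <= D0 * (3 * Q) by rewrite ler_wpM2l.
have uV : u * V <= (5 / 3) ^+ n * (V * ((1 + u) * q ^+ n)).
  rewrite [leRHS](_ : _ = ((5 / 3 * q) ^+ n * (1 + u)) * V); last first.
    by rewrite [(5 / 3 * q) ^+ n]exprMn; ring.
  rewrite ler_wpM2r// -[leLHS]mul1r ler_pM//; last by rewrite lerDr.
  apply: exprn_ege1.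
  have : (1 + u)^-1 <= 5^-1 by rewrite lef_pV2 ?posrE//; lra.
  by rewrite /q; lra.
have : u * ln u <= u * (V + (D0 + D1)) by rewrite ler_wpM2l.
lra.
Qed.

End entropy_pointwise.

(** * The entropy inequality for functions of unit L^2 norm *)

Section entropy_energy.
Context {R : realType}.
Variable alpha : R.
Hypothesis alpha_gt1 : 1 < alpha.
Hypothesis alpha_le2 : alpha <= 2.
Let beta := conj_exp alpha.
Let mu := mu_alpha alpha_gt1.

Let beta_ge2 : 2 <= beta. Proof. exact: conj_exp_ge2. Qed.

Let j := Num.truncn beta.
Let n := j.*2.+2.

Let n_large : n%:R <= n.-1%:R * alpha.
Proof.
have nb : beta <= n%:R.
  apply: ltW; apply: (lt_le_trans (truncnS_gt beta)).
  by rewrite ler_nat /n -addnn ltnS (leq_trans (leq_addr j j)).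
have : alpha <= n%:R * (alpha - 1).
  by rewrite -ler_pdivrMr ?subr_gt0// -conj_expE.
by rewrite -[n%:R]natr1 /=; lra.
Qed.

Let Z := Zconst alpha.
(** [C1] is the Poincare constant, [Kb] the energy coefficient in [weighted_moment], and
    [D0 + D1 * E] the bound on u e^(-V). [C] adds up the contributions of Q, V Psi and u. *)
Let C1 : R := 32 * expR 1 ^+ 2 * beta.
Let Kb : R := (4 * (1 + 2 * n%:R)) `^ beta.
Let D0 : R := 3 + Z.
Let D1 : R := 2 * C1 + Z * beta.
Let C : R := (5 + 3 * D0) * (12 * C1) +
  (5 / 3) ^+ n * (2 * (2 * (12 * C1) + Kb)) + D1.

Let beta_gt0 : 0 < beta. Proof. exact: lt_le_trans beta_ge2. Qed.
Let Z_gt0 : 0 < Z. Proof. exact: Zconst_gt0. Qed.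
Let C1_gt0 : 0 < C1.
Proof. by rewrite !mulr_gt0// exprn_gt0// expR_gt0. Qed.
Let D0_gt0 : 0 < D0. Proof. by rewrite addr_gt0. Qed.
Let D1_gt0 : 0 < D1. Proof. by rewrite addr_gt0 ?mulr_gt0. Qed.
Let K0_ge0 : 0 <= (5 / 3 : R) ^+ n. Proof. by rewrite exprn_ge0// divr_ge0. Qed.
Let Kb_ge0 : 0 <= Kb. Proof. exact: powR_ge0. Qed.

Let C_gt0 : 0 < C.
Proof.
have h1 : 0 < (5 + 3 * D0) * (12 * C1).
  by rewrite mulr_gt0// ?addr_gt0// mulr_gt0.
have h2 : 0 <= (5 / 3) ^+ n * (2 * (2 * (12 * C1) + Kb)).
  rewrite mulr_ge0// mulr_ge0// addr_ge0// mulr_ge0// mulr_ge0// ltW//.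
by rewrite /C; have := D1_gt0; lra.
Qed.

Section normalized.
Variables f df : R -> R.
Hypothesis is_derive_f : forall x : R, is_derive x (1 : R) f (df x).
Hypothesis continuous_df : continuous df.
Hypothesis f_norm1 : (\int[mu]_x (f x ^+ 2)%:E = 1)%E.
Let G := energy alpha f df.
Hypothesis G_fin : (\int[mu]_x (G x)%:E < +oo)%E.

Let u x : R := f x ^+ 2.
Let k x : R := Num.sqrt (1 + u x).
Let Q x : R := (u x - 1) ^+ 2 / (1 + u x).
Let Psi x : R := (1 + u x) * (1 - 2 * (1 + u x)^-1) ^+ n.
Let V (x : R) : R := `|x| `^ alpha.
Let E := expect mu G.

Let alpha_gt0 : 0 < alpha. Proof. exact: lt_trans alpha_gt1. Qed.
Let cf : continuous f. Proof. exact: is_derive_continuous. Qed.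
Let mf : measurable_fun setT f. Proof. exact: continuous_measurable_fun. Qed.
Let u_ge0 x : 0 <= u x. Proof. exact: sqr_ge0. Qed.
Let u1_gt0 x : 0 < 1 + u x. Proof. by rewrite ltr_pwDl. Qed.
Let mu_u : measurable_fun setT u. Proof. exact: measurable_funX. Qed.
Let cu1 : continuous (fun x => 1 + u x).
Proof. by apply: continuous_funD; [exact: cst_continuous|exact: continuous_funX]. Qed.
Let cu1V : continuous (fun x => (1 + u x)^-1).
Proof. by apply: continuous_funV => // x; rewrite gt_eqF. Qed.

Let G_ge0 x : 0 <= G x. Proof. exact: energy_ge0. Qed.
Let mG : measurable_fun setT G.
Proof. by apply: measurable_energy => //; exact: continuous_measurable_fun. Qed.
Let iG : L1 mu G. Proof. exact: ge0_L1. Qed.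
Let E_ge0 : 0 <= E. Proof. exact: expect_ge0. Qed.

Let iu : L1 mu u.
Proof. by apply: ge0_L1 => //; rewrite f_norm1 ltry. Qed.

Let Eu : expect mu u = 1.
Proof. by rewrite /expect /Rintegral f_norm1. Qed.

Let k_gt0 x : 0 < k x. Proof. by rewrite sqrtr_gt0. Qed.
Let k_ge1 x : 1 <= k x.
Proof. by rewrite -[leLHS]sqrtr1 ler_wsqrtr// lerDl. Qed.
Let k_sqr x : k x ^+ 2 = 1 + u x. Proof. by rewrite sqr_sqrtr// ltW. Qed.

Let mk : measurable_fun setT k.
Proof.
apply: continuous_measurable_fun => x; apply: continuous_comp; first exact: cu1.
exact: sqrt_continuous.
Qed.

Let ik2 : L1 mu (fun x => k x ^+ 2).
Proof. by under eq_fun do rewrite k_sqr; exact: (L1D _ _ _ (L1_cst _ 1) iu). Qed.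

Let Ek2 : expect mu (fun x => k x ^+ 2) = 2.
Proof.
under eq_fun do rewrite k_sqr.
by rewrite (expectD _ _ _ (L1_cst _ 1) iu) expect_cst Eu.
Qed.

Let ik : L1 mu k.
Proof.
apply: (@L1_le _ _ _ mu k _ mk ik2) => x.
by rewrite ger0_norm ?expr2 ?ler_peMr// ltW.
Qed.

Let P := expect mu (fun x => (k x - k 0) ^+ 2).

Let iP : L1 mu (fun x => (k x - k 0) ^+ 2).
Proof. exact: (expect_sqrB _ _ (k 0) ik ik2).1. Qed.

Let P_le : P <= C1 * E.
Proof.
have := poincare_sqrt alpha alpha_gt1 alpha_le2 f df is_derive_f continuous_df.
by rewrite (expectE _ _ iP) (expectE _ _ iG) -EFinM lee_fin.
Qed.

Let Q_ge0 x : 0 <= Q x. Proof. by rewrite divr_ge0 ?sqr_ge0// ltW. Qed.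

Let cQ : continuous Q.
Proof.
apply: continuous_funM => //; apply: continuous_funX; apply: continuous_funB.
  exact: continuous_funX.
exact: cst_continuous.
Qed.

(** The L^2 norm of k, as k^2 = 1 + u has mean 2. *)
Let r2 : R := Num.sqrt 2.
Let r2_gt0 : 0 < r2. Proof. by rewrite sqrtr_gt0. Qed.
Let r2_sqr : r2 ^+ 2 = 2. Proof. by rewrite sqr_sqrtr. Qed.

(** Here u - 1 = (k - r2) (k + r2), and (k + r2)^2 <= 6 k^2 since k >= 1. *)
Let Q_le x : Q x <= 6 * (k x - r2) ^+ 2.
Proof.
rewrite /Q -k_sqr ler_pdivrMr ?exprn_gt0//.
have -> : u x - 1 = k x ^+ 2 - r2 ^+ 2 by rewrite k_sqr r2_sqr; ring.
have -> : (k x ^+ 2 - r2 ^+ 2) ^+ 2 = (k x - r2) ^+ 2 * (k x + r2) ^+ 2 by ring.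
have -> : 6 * (k x - r2) ^+ 2 * k x ^+ 2 = (k x - r2) ^+ 2 * (6 * k x ^+ 2).
  by ring.
rewrite ler_wpM2l ?sqr_ge0//.
have k1 := k_ge1 x.
have kk : 1 <= k x ^+ 2 by rewrite exprn_ege1.
have := sqr_ge0 (k x - r2); rewrite sqrrB sqrrD r2_sqr.
have r32 : r2 <= 3 / 2.
  by rewrite -(@ler_pXn2r _ 2)// ?nnegrE ?divr_ge0 ?(ltW r2_gt0)// r2_sqr; lra.
have : 0 <= k x * (k x - 1) by rewrite mulr_ge0//; lra.
have : k x * r2 <= k x * (3 / 2) by rewrite ler_wpM2l// ltW.
rewrite expr2; lra.
Qed.

Let ir : L1 mu (fun x => (k x - r2) ^+ 2).
Proof. exact: (expect_sqrB _ _ r2 ik ik2).1. Qed.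

Let iQ : L1 mu Q.
Proof.
apply: (@L1_le _ _ _ mu Q _ _ (L1Z _ 6 _ ir)); first exact: continuous_measurable_fun.
by move=> x; rewrite ger0_norm.
Qed.

(** [expect_sqrB_norm] moves the centre from [r2] to k(0), where the Poincare inequality applies; 12
    is 6 times its factor 2. *)
Let EQ : expect mu Q <= 12 * C1 * E.
Proof.
apply: (le_trans (expect_le _ _ _ iQ (L1Z _ 6 _ ir) Q_le)); rewrite expectZ//.
have := @expect_sqrB_norm _ _ _ mu k r2 (k 0) r2_gt0 (fun x => ltW (k_gt0 x)) ik ik2.
rewrite r2_sqr => /(_ Ek2); rewrite -/P; have := P_le; lra.
Qed.

Let q_le x : `|1 - 2 * (1 + u x)^-1| <= 1.
Proof.
have v1 : (1 + u x)^-1 <= 1 by rewrite invf_le1// lerDl.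
have v2 : 0 < (1 + u x)^-1 by rewrite invr_gt0.
by rewrite ler_norml; apply/andP; split; lra.
Qed.

Let Psi_ge0 x : 0 <= Psi x.
Proof.
rewrite mulr_ge0 ?(ltW (u1_gt0 _))// exprn_even_ge0//=.
by rewrite negbK odd_double.
Qed.

Let Psi_le x : Psi x <= Q x.
Proof.
have un : 1 + u x != 0 by rewrite gt_eqF.
have -> : Q x = (1 + u x) * (1 - 2 * (1 + u x)^-1) ^+ 2 by rewrite /Q; field.
apply: ler_wpM2l; first exact: ltW.
rewrite -[leLHS]ger0_norm; last first.
  by rewrite exprn_even_ge0//= negbK odd_double.
rewrite -[leRHS](real_normK (num_real _)) normrX.
by rewrite ler_wiXn2l.
Qed.

Let mPsi : measurable_fun setT Psi.
Proof.
apply: continuous_measurable_fun; apply: continuous_funM => //.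
apply: continuous_funX; apply: continuous_funB; first exact: cst_continuous.
by apply: continuous_funM => //; exact: cst_continuous.
Qed.

Let iPsi : L1 mu Psi.
Proof. by apply: (@L1_le _ _ _ mu Psi _ mPsi iQ) => x; rewrite ger0_norm. Qed.

Let VPsi_ge0 x : 0 <= V x * Psi x.
Proof. by rewrite mulr_ge0 ?powR_ge0. Qed.

Let i2 : L1 mu (fun x => 2 * Psi x + Kb * G x).
Proof. by apply: L1D; exact: L1Z. Qed.

Let EVPsi : L1 mu (fun x => V x * Psi x) /\
  expect mu (fun x => V x * Psi x) <= 2 * (2 * (12 * C1) + Kb) * E.
Proof.
have := weighted_moment alpha alpha_gt1 alpha_le2 f df is_derive_f
  continuous_df j n_large.
rewrite (expectE _ _ i2) -EFinM => le_mom.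
have iVP : L1 mu (fun x => V x * Psi x).
  apply: ge0_L1 => //; last by apply: le_lt_trans le_mom _; rewrite ltry.
  apply: measurable_funM => //; apply: continuous_measurable_fun.
  exact: continuous_norm_powR.
split=> //; move: le_mom; rewrite (expectE _ _ iVP) lee_fin => le_mom.
apply: (le_trans le_mom); rewrite expectD; [|exact: L1Z..].
have := le_trans (expect_le _ _ _ iPsi iQ Psi_le) EQ.
by rewrite !expectZ// -/E; lra.
Qed.

(** The value u(0) in [exp_power_sup_bound] is itself bounded: averaging k(0)^2 <= 2 k^2 + 2 (k -
    k(0))^2 gives u(0) <= 3 + 2 C1 E. *)
Let u_le x : u x * expR (- V x) <= D0 + D1 * E.
Proof.
have iuG : L1 mu (fun x => u x + beta * G x) by apply: L1D => //; exact: L1Z.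
have := exp_power_sup_bound alpha alpha_gt1 alpha_le2 f df is_derive_f
  continuous_df x.
rewrite (expectE _ _ iuG) -EFinM -EFinD lee_fin => /le_trans; apply.
rewrite expectD//; last exact: L1Z.
rewrite Eu expectZ// -/E.
have k0 : k 0 ^+ 2 <= 4 + 2 * P.
  rewrite -(expect_cst mu (k 0 ^+ 2)).
  rewrite (_ : 4 + 2 * P =
    expect mu (fun x => 2 * k x ^+ 2 + 2 * (k x - k 0) ^+ 2)).
    apply: expect_le; [exact: L1_cst|by apply: L1D; exact: L1Z|].
    by move=> y; have := sqr_ge0 (2 * k y - k 0); lra.
  rewrite expectD; [|exact: L1Z..].
  by rewrite !expectZ// Ek2 -/P; ring.
move: k0; rewrite k_sqr -/(u 0) -/Z /D0 /D1 => k0.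
by have := P_le; lra.
Qed.

(** Integrates [entropy_pointwise] with [D1 * E] in place of [D1]. The term u - 1 has mean zero, and
    every other term has mean at most a multiple of E. *)
Lemma entropy_energy_unit : L1 mu (fun x => f x ^+ 2 * ln (f x ^+ 2)) /\
  (\int[mu]_x (f x ^+ 2 * ln (f x ^+ 2))%:E <= C%:E * \int[mu]_x (G x)%:E)%E.
Proof.
have [iVP EVP] := EVPsi.
pose T x := ((u x + (- 1)) + (5 + 3 * D0) * Q x +
  (5 / 3) ^+ n * (V x * Psi x)) + D1 * E * u x.
have T_ge x : u x * ln (u x) <= T x.
  apply: entropy_pointwise => //; [by rewrite /= negbK odd_double
    |exact: powR_ge0|exact: ltW|by rewrite mulr_ge0// ltW].
have iT1 := L1D _ _ _ iu (L1_cst mu (- 1)).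
have iT2 := L1D _ _ _ iT1 (L1Z _ (5 + 3 * D0) _ iQ).
have iT3 := L1D _ _ _ iT2 (L1Z _ ((5 / 3) ^+ n) _ iVP).
have iT : L1 mu T := L1D _ _ _ iT3 (L1Z _ (D1 * E) _ iu).
have ET : expect mu T <= C * E.
  rewrite (expectD _ _ _ iT3 (L1Z _ (D1 * E) _ iu)).
  rewrite (expectD _ _ _ iT2 (L1Z _ ((5 / 3) ^+ n) _ iVP)).
  rewrite (expectD _ _ _ iT1 (L1Z _ (5 + 3 * D0) _ iQ)).
  rewrite (expectD _ _ _ iu (L1_cst mu (- 1))) !expectZ// expect_cst Eu subrr add0r.
  have h1 : (5 + 3 * D0) * expect mu Q <= (5 + 3 * D0) * (12 * C1 * E).
    by rewrite ler_wpM2l// addr_ge0// mulr_ge0// ltW.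
  have h2 := ler_wpM2l K0_ge0 EVP.
  by rewrite /C; lra.
have mln : measurable_fun setT (fun x => u x * ln (u x)).
  apply: measurable_funM => //; exact: measurableT_comp.
have iln : L1 mu (fun x => u x * ln (u x)).
  (* As u ln u >= u - 1 >= -1, also T >= -1, so T + 2 dominates |u ln u|. *)
  apply: (@L1_le _ _ _ mu _ _ mln (L1D _ _ _ iT (L1_cst mu 2))) => x.
  have := T_ge x; have := mulr_ln_ge _ (u_ge0 x); have := u_ge0 x.
  by move=> h0 h1 h2; rewrite ler_norml; apply/andP; split; lra.
split=> //; rewrite (expectE _ _ iG) (expectE _ _ iln) -EFinM lee_fin (le_trans _ ET)//.
exact: expect_le.
Qed.

End normalized.

Lemma entropy_energy : exists2 C : R, 0 < C &
  forall f df : R -> R, (forall x : R, is_derive x (1 : R) f (df x)) ->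
  continuous df -> (\int[mu]_x (f x ^+ 2)%:E = 1)%E ->
  (\int[mu]_x (energy alpha f df x)%:E < +oo)%E ->
  L1 mu (fun x => f x ^+ 2 * ln (f x ^+ 2)) /\
  (\int[mu]_x (f x ^+ 2 * ln (f x ^+ 2))%:E <=
   C%:E * \int[mu]_x (energy alpha f df x)%:E)%E.
Proof. by exists C => // f df *; exact: entropy_energy_unit. Qed.

End entropy_energy.

(** * Homogeneity and reduction to unit norm *)

Section energy_scaling.
Context {R : realType}.
Implicit Types f df : R -> R.

Lemma eHfun_quotE (alpha : R) f df x :
  (eHfun 1 alpha (quot (df x) (f x)) * (f x ^+ 2)%:E)%E = (energy alpha f df x)%:E.
Proof.
rewrite /energy; case: ifPn => [/eqP ->|f0].
  by rewrite expr0n mule0.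
by rewrite /quot (negPf f0) andbF inver (negPf f0).
Qed.

(** The quotient f'/f is invariant under scaling, so only the factor f^2 changes. *)
Lemma energyZ (alpha c : R) f df x : c != 0 ->
  energy alpha (fun y => c * f y) (fun y => c * df y) x =
  c ^+ 2 * energy alpha f df x.
Proof.
move=> c0; rewrite /energy mulf_eq0 (negPf c0)/=.
case: ifPn => [_|f0]; first by rewrite mulr0.
by rewrite -mulf_div divff// mul1r exprMn mulrCA.
Qed.

End energy_scaling.

Theorem mainTheorem6 (R : realType) (alpha : R)
    (alpha_gt1 : 1 < alpha) (alpha_le2 : alpha <= 2) :
  exists a C : R, 0 < a /\ LSI (mu_alpha alpha_gt1) a alpha C.
Proof.
have [C C0 ent_le] := entropy_energy alpha alpha_gt1 alpha_le2.
exists 1, C; split => // f sf f2; set mu := mu_alpha alpha_gt1.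
pose df := (f^`()%classic : R -> R).
have dfE (x : R) : is_derive x (1 : R) f (df x).
  by apply: DeriveDef; [exact: (sf 0)|rewrite /df derive1E].
have cdf : continuous df.
  move=> x; apply/differentiable_continuous/derivable1_diffP; exact: (sf 1).
have cf : continuous f by exact: (is_derive_continuous _ _ dfE).
have mf : measurable_fun setT f by exact: continuous_measurable_fun.
have mG : measurable_fun setT (energy alpha f df).
  by apply: measurable_energy => //; exact: continuous_measurable_fun.
have G_ge0 x : 0 <= energy alpha f df x by exact: energy_ge0.
under eq_integral do rewrite eHfun_quotE.
have if2 : L1 mu (fun x => f x ^+ 2) := Lfun2_integrable_sqr f2.
set s := expect mu (fun x => f x ^+ 2).
have s0 : 0 <= s by apply: expect_ge0 => x; exact: sqr_ge0.
have -> : Ent mu (fun x => f x ^+ 2) =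
  (\int[mu]_x (f x ^+ 2 * ln (f x ^+ 2 / s))%:E)%E by [].
(* For s = 0 the conventions x / 0 = 0 and ln 0 = 0 make the entropy vanish. *)
have [sE|sn0] := eqVneq s 0.
  rewrite [leLHS]integral0_eq => [|x _]; last by rewrite sE invr0 mulr0 ln0// mulr0.
  rewrite mule_ge0 ?lee_fin ?(ltW C0)// integral_ge0// => x _.
  by rewrite lee_fin.
have sp : 0 < s by rewrite lt_neqAle eq_sym sn0.
have [Goo|Gfin] := eqVneq (\int[mu]_x (energy alpha f df x)%:E)%E +oo%E.
  by rewrite Goo gt0_muley ?lte_fin// leey.
(* Normalizes c f to unit norm; entropy and energy are then both multiplied by 1 / s. *)
pose c := (Num.sqrt s)^-1.
have c0 : c != 0 by rewrite invr_eq0 gt_eqF// sqrtr_gt0.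
have c2 : c ^+ 2 = s^-1 by rewrite exprVn sqr_sqrtr.
have iG : L1 mu (energy alpha f df) by apply: ge0_L1; rewrite // ltey.
have GE x : energy alpha (fun y => c * f y) (fun y => c * df y) x =
  s^-1 * energy alpha f df x by rewrite energyZ// c2.
have fE x : (c * f x) ^+ 2 = s^-1 * f x ^+ 2 by rewrite exprMn c2.
have dcfE (x : R) : is_derive x (1 : R) (fun y => c * f y) (c * df x).
  exact: is_deriveZ.
have cdcf : continuous (fun y => c * df y).
  by apply: continuous_funM => //; exact: cst_continuous.
have := ent_le _ _ dcfE cdcf.
under [in X in X -> _]eq_integral do rewrite fE.
rewrite (expectE _ _ (L1Z _ s^-1 _ if2)) expectZ// -/s mulVf// => /(_ erefl).
under [in X in X -> _]eq_integral do rewrite GE.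
rewrite (expectE _ _ (L1Z _ s^-1 _ iG)) => /(_ (ltry _)) [iln le_ln].
have lnE x : f x ^+ 2 * ln (f x ^+ 2 / s) =
    s * ((c * f x) ^+ 2 * ln ((c * f x) ^+ 2)).
  by rewrite fE (mulrC s^-1) mulrA mulrCA divff// mulr1.
under [leLHS]eq_integral do rewrite lnE.
rewrite (expectE _ _ (L1Z _ s _ iln)) expectZ// (expectE _ _ iG) -EFinM lee_fin.
move: le_ln; rewrite (expectE _ _ iln).
rewrite expectZ// -EFinM lee_fin => le_ln.
by rewrite -ler_pdivlMl// mulrCA.
Qed.
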